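(* Let $n$ be even and let $L\in\mathcal L$ be an oriented spin rational homology sphere (of dimension $n$), with the trivial rank one local system and the Maurer–Cartan element $b=0$. Suppose that $HF^\bullet(L,0)\cong\Lambda\times\Lambda$ as a ring. Then there exist idempotents $e_L^{+},e_L^{-}\in QH^\bullet(X)$ such that $QH^\bullet(X)\,e_L^{\pm}\cong\Lambda$ and $e_L^+*e_L^-=0$. Moreover these idempotents are eigenvectors of the operator $c_1*$ with the same eigenvalue, where $c_1$ is the first Chern class of the tangent bundle of $X$.
   Context: **Setting.** $(X,\omega)$ is a compact symplectic manifold of real dimension $2n$ with a compatible almost complex structure. $\Lambda=\{\sum_{i\ge0}a_iT^{\lambda_i}\mid a_i\in\mathbb C,\lambda_i\in\mathbb R,\lambda_i\to\infty\}$ is the universal Novikov field (algebraically closed), $\Lambda_+$ the maximal ideal of its valuation ring. Everything is $\mathbb Z/2$-graded; $|x|'=|x|-1$. $QH^\bullet(X)=H^\bullet(X;\Lambda)$ with quantum product $*$: $\langle x_1*x_2,x_3\rangle_X=\sum_{\alpha\in H_2(X;\mathbb Z)}T^{\omega(\alpha)/2\pi}\mathrm{GW}_3(\alpha;x_1,x_2,x_3)$ (genus $0$ Gromov–Witten invariants), $\langle x,y\rangle_X=\int_Xx\cup y$, unit $1_X$. **Disk operators.** For a compact oriented spin Lagrangian $L$ with Maslov class $\mu_L\in H^2(X,L;\mathbb Z)$ one is given the Fukaya–Oh–Ohta–Ono maps $m_{s,\beta}:H^\bullet(L;\mathbb C)^{\otimes s}\to H^\bullet(L;\mathbb C)$,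 $\beta\in H_2(X,L;\mathbb Z)$, built from moduli spaces $\mathscr M_{s+1}(L;\beta)$ of stable disks of class $\beta$ with $s+1$ boundary marked points, with: (i) degree $2-s-\mu_L(\beta)$; (ii) $m_{s,\beta}\neq0$ implies $\beta=\beta_1+\cdots+\beta_m$ with $\mathscr M_{s+1}(L;\beta_i)\ne\emptyset$; (iii) $m_{0,0}=m_{1,0}=0$, $m_{2,0}(x_1,x_2)=(-1)^{|x_1||x_2|+|x_1|}x_1\cup x_2$; (iv) $\sum_{s_1+s_2=s+1,\,\beta_1+\beta_2=\beta}(-1)^{|x_1|'+\cdots+|x_i|'}m_{s_1,\beta_1}(x_1,\dots,x_i,m_{s_2,\beta_2}(x_{i+1},\dots),\dots,x_s)=0$; (v) $m_{s,\beta}(\dots,1_L,\dots)=0$ if $\beta\ne0$ or $s\ge3$; (vi) $\langle m_{s,\beta}(x_1,\dots,x_s),x_0\rangle_{\rm cyc}=(-1)^{|x_0|'(|x_1|'+\cdots+|x_s|')}\langle m_{s,\beta}(x_0,\dots,x_{s-1}),x_s\rangle_{\rm cyc}$ for $\langle x_1,x_2\rangle_{\rm cyc}=(-1)^{|x_1||x_2|+|x_1|}\int_Lx_1\cup x_2$. A Maurer–Cartan element is a pair $b=(\rho,b_+)$, $\rho:\pi_1(L)\to\mathbb C^\times$, $b_+\in H^{\rm odd}(L;\Lambda_+)$, with $\sum_{s,\beta}\rho(\partial\beta)T^{\omega(\beta)/2\pi}m_{s,\beta}(b_+,\dots,b_+)=W_{L,b}\cdot1_L$ for some $W_{L,b}\in\Lambda$;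 $L$ is weakly unobstructed if one exists. **Fukaya category (standing assumption).** $\mathcal L$ is a finite set of weakly unobstructed, pairwise transverse, compact oriented spin Lagrangians. There is an $n$-cyclic strictly unital $A_\infty$ category $\mathrm{Fuk}(X)^{\mathcal L}$ over $\Lambda$ (finite-dimensional hom spaces, non-degenerate degree-$n$ pairings $\langle\,,\rangle_{\rm cyc}:\hom(A,B)\otimes\hom(B,A)\to\Lambda$ with $\langle m_{s-1}(x_1,\dots,x_{s-1}),x_s\rangle_{\rm cyc}=(-1)^{|x_s|'(|x_1|'+\cdots+|x_{s-1}|')}\langle m_{s-1}(x_s,x_1,\dots,x_{s-2}),x_{s-1}\rangle_{\rm cyc}$). Objects: pairs $(L,b)$ with $L\in\mathcal L$, $b$ a Maurer–Cartan element of $L$. $\hom((L_1,b_1),(L_2,b_2))$ is $0$ if $W_{L_1,b_1}\ne W_{L_2,b_2}$; otherwise $H^\bullet(L_1;\mathscr Hom(\rho_1,\rho_2))\otimes\Lambda$ if $L_1=L_2$ (local system $\rho_2\rho_1^{-1}$), and $\bigoplus_{p\in L_1\cap L_2}\Lambda\langle p\rangle$ if $L_1\neq L_2$. For objects $(L,b_i)$, $b_i=(\rho,b_{i,+})$, with the same $L,\rho,W$: $m_s(x_1,\dots,x_s)=\sum_{l_i\ge0,\beta}\rho(\partial\beta)T^{\omega(\beta)/2\pi}m_{s+l_0+\cdots+l_s,\beta}(b_{0,+}^{\otimes l_0},x_1,b_{1,+}^{\otimes l_1},\dots,x_s,b_{s,+}^{\otimes l_s})$, unit $1_L$, pairing as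 in (vi). $HF^\bullet(L,b)=H^\bullet\hom((L,b),(L,b))$ is a ring with $x\cdot y=(-1)^{|x||y|+|x|}[m_2](x,y)$. **Open-closed maps (standing assumption).** $HH^\bullet$, $HH_\bullet$ are Hochschild cohomology (a unital ring) and homology (a module over it by cap product), $\langle\,,\rangle_{\rm Muk}$ the Mukai pairing on $HH_\bullet$; on length-$0$ classes $x_0\in H^\bullet\hom(A,A)$, $x_0'\in H^\bullet\hom(A',A')$ it is $\mathrm{str}(x''\mapsto(-1)^{|x_0||x''|+|x_0||x_0'|}x_0\cdot x''\cdot x_0')$ on $H^\bullet\hom(A,A')$. The cyclic structure gives $\langle\varphi,x_0[x_1|\cdots|x_s]\rangle_{\rm cyc}=(-1)^{|x_0|'(|x_1|'+\cdots+|x_s|')}\langle\varphi_s(x_1,\dots,x_s),x_0\rangle_{\rm cyc}$ on $HH^\bullet\otimes HH_\bullet$. There is $\mathfrak q:QH^\bullet(X)\to HH^\bullet(\mathrm{Fuk}(X)^{\mathcal L})$; $\mathfrak p:HH_\bullet(\mathrm{Fuk}(X)^{\mathcal L})\to QH^{\bullet+n}(X)$ is defined by $\langle x,\mathfrak p(\mathbb X)\rangle_X=(-1)^{n|\mathbb X|}\langle\mathfrak q(x),\mathbb X\rangle_{\rm cyc}$. They satisfy: (1) $\mathfrak q$ is a unital ring homomorphism; (2) for $\eta\in H^2_c(X\setminus L;\mathbb C)$ the length-$0$ component of $\mathfrak q(\eta)$ at $(L,b)$ is $\sum_{\beta,s}\langle\eta,\beta\rangle\rho(\partial\beta)T^{\omega(\beta)/2\pi}m_{s,\beta}(b_+,\dots,b_+)$;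 (3) $\langle\mathfrak p(\mathbb X),\mathfrak p(\mathbb X')\rangle_X=(-1)^{n(n+1)/2+\sigma}\langle\mathbb X,\mathbb X'\rangle_{\rm Muk}$ with $\sigma$ depending only on the parities of $n$ and $|\mathbb X|$; (4) $\mathfrak p(1_L)=[L]$, where $\int_Lx|_L=\int_X[L]\cup x$. **Spheres.** An even-dimensional oriented spin Lagrangian rational homology sphere is weakly unobstructed and, with the trivial local system, $b=0$ is its unique Maurer–Cartan element (known result of Fukaya–Oh–Ohta–Ono). *)

(* Defs.v *)
From HB Require Import structures.
From mathcomp Require Import all_boot all_order all_algebra.
From mathcomp Require Import all_classical all_reals trigo.
From mathcomp Require Import complex.
From mathcomp Require Import lra.

Set Implicit Arguments.
Unset Strict Implicit.
Unset Printing Implicit Defensive.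

Import Order.TTheory GRing.Theory Num.Theory.

Local Open Scope classical_set_scope.
Local Open Scope ring_scope.

Section LeftFinite.
Variables (R : realType) (K : fieldType).
Implicit Types f g h : R -> K.

Definition lfinite f := forall E, finite_set [set x | f x != 0 /\ x <= E].

Definition conv f g : R -> K :=
  fun x => \sum_(y \in [set: R]) f y * g (x - y).

Lemma lfinite_seq f E : lfinite f ->
  exists2 s : seq R, uniq s & forall x, f x != 0 -> x <= E -> x \in s.
Proof.
move=> /(_ E) /finite_seqP[s sE]; exists (undup s); first exact: undup_uniq.
move=> x fx xE; rewrite mem_undup.
by have : [set x | f x != 0 /\ x <= E] x by []; rewrite sE.
Qed.

Lemma seq_lfinite f :
  (forall E, exists s : seq R, forall x, f x != 0 -> x <= E -> x \in s) -> lfinite f.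
Proof.
move=> H E; have [s sP] := H E.
apply: (@sub_finite_set _ _ [set` s]); last exact: finite_seq.
by move=> x [fx xE]; exact: sP.
Qed.

Lemma seq_lb (s : seq R) : exists m : R, forall x, x \in s -> m <= x.
Proof.
elim: s => [|a s [m mP]]; first by exists 0.
exists (Num.min a m) => x; rewrite inE => /orP[/eqP->|/mP mx].
  by rewrite ge_min lexx.
by rewrite ge_min mx orbT.
Qed.

Lemma lfinite_lb f : lfinite f -> exists m, forall x, f x != 0 -> m <= x.
Proof.
move=> /(@lfinite_seq _ 0)[s _ sP]; have [m mP] := seq_lb s.
exists (Num.min 0 m) => x fx; rewrite ge_min.
by case: (lerP 0 x) => //= x0; rewrite mP// sP// ltW.
Qed.

Lemma convE f g x (A B : seq R) : uniq A -> uniq B ->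
  (forall a b, f a != 0 -> g b != 0 -> a + b = x -> a \in A /\ b \in B) ->
  conv f g x = \sum_(a <- A) \sum_(b <- B) (if a + b == x then f a * g b else 0).
Proof.
move=> uA uB AB; rewrite /conv.
have -> : \sum_(y \in [set: R]) f y * g (x - y) = \sum_(a <- A) f a * g (x - a).
  rewrite (@fsbig_seq _ _ _ _ A (fun a => f a * g (x - a)) uA); apply/esym/fsbig_widen => // y [_ /= yA].
  have [->|fy] := eqVneq (f y) 0; first by rewrite mul0r.
  have [->|gy] := eqVneq (g (x - y)) 0; first by rewrite mulr0.
  by have [] := AB y (x - y) fy gy; rewrite ?subrKC// => /yA.
apply: eq_bigr => a _.
have eqab b : (a + b == x) = (b == x - a) by rewrite [RHS]eq_sym subr_eq addrC eq_sym.
have [xaB|xaB] := boolP (x - a \in B).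
  rewrite (bigD1_seq _ xaB uB)/= eqab eqxx big1 ?addr0// => b bxa.
  by rewrite eqab (negbTE bxa).
rewrite big_seq big1; last first.
  move=> b bB; rewrite eqab; case: eqP => // bxa.
  by rewrite -bxa bB in xaB.
have [->|fa] := eqVneq (f a) 0; first by rewrite mul0r.
have [->|ga] := eqVneq (g (x - a)) 0; first by rewrite mulr0.
by have [] := AB a (x - a) fa ga; rewrite ?subrKC// (negbTE xaB).
Qed.

Lemma conv_boxP f g E : lfinite f -> lfinite g -> exists A B : seq R,
  [/\ uniq A, uniq B &
      forall a b, f a != 0 -> g b != 0 -> a + b <= E -> a \in A /\ b \in B].
Proof.
move=> ff fg; have [lf lfP] := lfinite_lb ff; have [lg lgP] := lfinite_lb fg.
have [A uA AP] := lfinite_seq (E - lg) ff.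
have [B uB BP] := lfinite_seq (E - lf) fg.
exists A, B; split => // a b fa gb abE.
by split; [apply: AP => //|apply: BP => //]; have := lgP _ gb; have := lfP _ fa; lra.
Qed.

Lemma conv_neq0 f g x : conv f g x != 0 ->
  exists a b, [/\ f a != 0, g b != 0 & a + b = x].
Proof.
move=> H; apply/not_existsP => nH; move/eqP: H; apply.
apply: fsbig1 => y _.
have [->|fy] := eqVneq (f y) 0; first by rewrite mul0r.
have [->|gy] := eqVneq (g (x - y)) 0; first by rewrite mulr0.
by exfalso; apply: (nH y); exists (x - y); rewrite subrKC.
Qed.

Lemma lfinite_conv f g : lfinite f -> lfinite g -> lfinite (conv f g).
Proof.
move=> ff fg; apply: seq_lfinite => E.
have [A [B [uA uB AB]]] := conv_boxP E ff fg.
exists [seq a + b | a <- A, b <- B] => x /conv_neq0[a [b [fa gb abx]]] xE.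
have [|aA bB] := AB a b fa gb; first by rewrite abx.
by apply/allpairsP; exists (a, b).
Qed.

Lemma convC f g : lfinite f -> lfinite g -> conv f g = conv g f.
Proof.
move=> ff fg; apply/funext => x.
have [A [B [uA uB AB]]] := conv_boxP x ff fg.
rewrite (convE uA uB); last by move=> a b fa gb abx; apply: AB => //; rewrite abx.
rewrite (convE uB uA); last first.
  by move=> b a gb fa bax; apply/and_comm/AB => //; rewrite addrC bax.
rewrite exchange_big/=; apply: eq_bigr => a _; apply: eq_bigr => b _.
by rewrite addrC mulrC.
Qed.

Lemma lfinite_bounds3 f g h x : lfinite f -> lfinite g -> lfinite h ->
  exists A B C : seq R, [/\ uniq A, uniq B, uniq C &
    forall a b c, f a != 0 -> g b != 0 -> h c != 0 -> a + b + c <= x ->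
       [/\ a \in A, b \in B & c \in C]].
Proof.
move=> ff fg fh; have [lf lfP] := lfinite_lb ff.
have [lg lgP] := lfinite_lb fg; have [lh lhP] := lfinite_lb fh.
have [A uA AP] := lfinite_seq (x - lg - lh) ff.
have [B uB BP] := lfinite_seq (x - lf - lh) fg.
have [C uC CP] := lfinite_seq (x - lf - lg) fh.
exists A, B, C; split => // a b c fa gb hc abcx.
have := lfP _ fa; have := lgP _ gb; have := lhP _ hc => hc' gb' fa'.
by split; [apply: AP|apply: BP|apply: CP] => //; lra.
Qed.

Lemma conv_convE f g h x : lfinite f -> lfinite g -> lfinite h ->
  forall A B C : seq R, uniq A -> uniq B -> uniq C ->
    (forall a b c, f a != 0 -> g b != 0 -> h c != 0 -> a + b + c <= x ->
       [/\ a \in A, b \in B & c \in C]) ->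
  conv (conv f g) h x = \sum_(a <- A) \sum_(b <- B) \sum_(c <- C)
     (if a + b + c == x then f a * g b * h c else 0).
Proof.
move=> ff fg fh A B C uA uB uC ABC.
pose Y := undup [seq a + b | a <- A, b <- B].
have uY : uniq Y by exact: undup_uniq.
rewrite (convE uY uC); last first.
  move=> y c /conv_neq0[a [b [fa gb <-]]] hc abcx.
  have [|aA bB cC] := ABC a b c fa gb hc; first by rewrite abcx.
  by split => //; rewrite mem_undup; apply/allpairsP; exists (a, b).
have fgE y c : h c != 0 -> y + c = x -> conv f g y =
   \sum_(a <- A) \sum_(b <- B) (if a + b == y then f a * g b else 0).
  move=> hc ycx; apply: convE => // a b fa gb aby.
  by have [|? ?] := ABC a b c fa gb hc; rewrite ?aby ?ycx//.
transitivity (\sum_(y <- Y) \sum_(c <- C) \sum_(a <- A) \sum_(b <- B)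
   (if (a + b == y) && (a + b + c == x) then f a * g b * h c else 0)).
  apply: eq_bigr => y _; apply: eq_bigr => c _.
  have [ycx|ycx] := eqVneq (y + c) x; last first.
    rewrite big1// => a _; rewrite big1// => b _.
    by case: eqP => //= ->; rewrite (negbTE ycx).
  have [hc0|hc] := eqVneq (h c) 0.
    rewrite hc0 mulr0 big1// => a _; rewrite big1// => b _.
    by rewrite mulr0 if_same.
  rewrite (fgE _ _ hc ycx) mulr_suml; apply: eq_bigr => a _.
  rewrite mulr_suml; apply: eq_bigr => b _.
  by case: eqP => [->|]/=; rewrite ?ycx ?eqxx ?mul0r.
under eq_bigr do rewrite exchange_big/=.
rewrite exchange_big/= big_seq [RHS]big_seq; apply: eq_bigr => a aA.
under eq_bigr do rewrite exchange_big/=.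
rewrite exchange_big/= big_seq [RHS]big_seq; apply: eq_bigr => b bB.
rewrite exchange_big/=; apply: eq_bigr => c _.
have abY : a + b \in Y by rewrite mem_undup; apply/allpairsP; exists (a, b).
rewrite (bigD1_seq _ abY uY)/= eqxx/= big1 ?addr0// => y yab.
by rewrite eq_sym (negbTE yab).
Qed.

Lemma convA f g h : lfinite f -> lfinite g -> lfinite h ->
  conv f (conv g h) = conv (conv f g) h.
Proof.
move=> ff fg fh; apply/funext => x.
rewrite (convC ff (lfinite_conv fg fh)).
have [A [B [C [uA uB uC ABC]]]] := lfinite_bounds3 x ff fg fh.
rewrite (conv_convE ff fg fh uA uB uC)//.
rewrite (conv_convE fg fh ff uB uC uA); last first.
  move=> b c a gb hc fa; rewrite addrC addrA => abcx.
  by have [] := ABC a b c fa gb hc abcx.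
rewrite [RHS]exchange_big/=; apply: eq_bigr => b _.
rewrite [RHS]exchange_big/=; apply: eq_bigr => c _.
apply: eq_bigr => a _.
by rewrite -(addrC a) addrA -(mulrA (f a)) (mulrC (f a)).
Qed.

Lemma convDl f g h : lfinite f -> lfinite g -> lfinite h ->
  conv (f + g) h = conv f h + conv g h.
Proof.
move=> ff fg fh; apply/funext => x.
change (conv (f + g) h x = conv f h x + conv g h x).
have [A [C [uA uC AC]]] := conv_boxP x ff fh.
have [B [D [uB uD BD]]] := conv_boxP x fg fh.
pose Z := undup (A ++ B); pose W := undup (C ++ D).
have uZ : uniq Z by exact: undup_uniq.
have uW : uniq W by exact: undup_uniq.
have sf a b : f a != 0 -> h b != 0 -> a + b = x -> a \in Z /\ b \in W.
  move=> fa hb abx; have [|] := AC a b fa hb; first by rewrite abx.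
  by rewrite !mem_undup !mem_cat => -> ->.
have sg a b : g a != 0 -> h b != 0 -> a + b = x -> a \in Z /\ b \in W.
  move=> fa hb abx; have [|] := BD a b fa hb; first by rewrite abx.
  by rewrite !mem_undup !mem_cat => -> ->; rewrite !orbT.
rewrite !(convE uZ uW)//; last first.
  move=> a b; have -> : (f + g) a = f a + g a by [].
  have [fa0|fa _] := eqVneq (f a) 0.
    by rewrite fa0 add0r; exact: sg.
  exact: sf.
rewrite -big_split/=; apply: eq_bigr => a _.
rewrite -big_split/=; apply: eq_bigr => b _.
by case: eqP => _; rewrite ?addr0// -mulrDl.
Qed.

Definition mono (l : R) (a : K) : R -> K := fun x => if x == l then a else 0.

Lemma lfinite_mono l a : lfinite (mono l a).
Proof.
apply: seq_lfinite => E; exists [:: l] => x; rewrite /mono inE.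
by case: (x == l) => //; rewrite eqxx.
Qed.

Lemma conv_monol l a f x : lfinite f -> conv (mono l a) f x = a * f (x - l).
Proof.
move=> ff; rewrite (@convE _ _ _ [:: l] [:: x - l])//; last first.
  move=> y b; rewrite /mono; case: (y =P l) => [-> _ _ lbx|_]; last by rewrite eqxx.
  by rewrite !inE eqxx -lbx [l + b]addrC addrK eqxx.
by rewrite !big_seq1 subrKC eqxx /mono eqxx.
Qed.

Lemma lfinite0 : lfinite 0.
Proof. by apply: seq_lfinite => E; exists [::] => x; rewrite eqxx. Qed.

Lemma lfiniteB f g : lfinite f -> lfinite g -> lfinite (f - g).
Proof.
move=> ff fg; apply: seq_lfinite => E.
have [A _ AP] := lfinite_seq E ff; have [B _ BP] := lfinite_seq E fg.
exists (A ++ B) => x fgx xE; rewrite mem_cat.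
have [fx0|fx] := eqVneq (f x) 0; last by rewrite AP.
rewrite orbC BP//; apply: contra_neq fgx => gx0.
by rewrite addrfctE opprfctE fx0 gx0 subrr.
Qed.

End LeftFinite.

(* Formal sums of T^(l_i) with l_i -> oo: coefficient functions f : R -> K   *)
(* whose support meets every half line ]-oo, E] in a finite set.             *)
Record novikov (R : realType) (K : fieldType) :=
  Novikov { ncoef : R -> K; _ : `[< lfinite ncoef >] }.

Section NovikovField.
Variables (R : realType) (K : fieldType).
Local Notation nov := (novikov R K).

HB.instance Definition _ := [isSub for @ncoef R K].
HB.instance Definition _ := [Choice of nov by <:].

Lemma ncoefP (a : nov) : lfinite (ncoef a).
Proof. by case: a => f /= /asboolP. Qed.

Definition mkNov f (H : lfinite f) : nov := Novikov (asboolT H).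

Lemma nov_inj (a b : nov) : ncoef a =1 ncoef b -> a = b.
Proof. by move=> ab; apply: val_inj; apply/funext. Qed.

Let nadd (a b : nov) : nov :=
  mkNov (lfiniteB (ncoefP a) (lfiniteB (@lfinite0 R K) (ncoefP b))).
Let nopp (a : nov) : nov := mkNov (lfiniteB (@lfinite0 R K) (ncoefP a)).
Let nzero : nov := mkNov (@lfinite0 R K).

Let addE a b x : ncoef (nadd a b) x = ncoef a x + ncoef b x.
Proof. by rewrite /= !(addrfctE, opprfctE) sub0r opprK. Qed.
Let oppE a x : ncoef (nopp a) x = - ncoef a x.
Proof. by rewrite /= !(addrfctE, opprfctE) sub0r. Qed.

Fact naddA : associative nadd.
Proof. by move=> a b c; apply: nov_inj => x; rewrite !addE addrA. Qed.
Fact naddC : commutative nadd.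
Proof. by move=> a b; apply: nov_inj => x; rewrite !addE addrC. Qed.
Fact nadd0 : left_id nzero nadd.
Proof. by move=> a; apply: nov_inj => x; rewrite !addE add0r. Qed.
Fact naddN : left_inverse nzero nopp nadd.
Proof. by move=> a; apply: nov_inj => x; rewrite addE oppE addNr. Qed.

HB.instance Definition _ := GRing.isZmodule.Build nov naddA naddC nadd0 naddN.

Lemma ncoef0 x : ncoef (0 : nov) x = 0. Proof. by []. Qed.
Lemma ncoefD (a b : nov) x : ncoef (a + b) x = ncoef a x + ncoef b x.
Proof. exact: addE. Qed.
Lemma ncoefN (a : nov) x : ncoef (- a) x = - ncoef a x.
Proof. exact: oppE. Qed.
Lemma ncoefB (a b : nov) x : ncoef (a - b) x = ncoef a x - ncoef b x.
Proof. by rewrite ncoefD ncoefN. Qed.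

Let nmul (a b : nov) : nov := mkNov (lfinite_conv (ncoefP a) (ncoefP b)).

(* the monomial c T^l *)
Definition nmono (l : R) (c : K) : nov := mkNov (lfinite_mono l c).

Let none := nmono 0 1.

Fact nmulA : associative nmul.
Proof.
by move=> a b c; apply/val_inj; rewrite /= convA//; exact: ncoefP.
Qed.
Fact nmulC : commutative nmul.
Proof. by move=> a b; apply/val_inj; rewrite /= convC//; exact: ncoefP. Qed.
Fact nmul1 : left_id none nmul.
Proof.
move=> a; apply: nov_inj => x; rewrite /= conv_monol ?mul1r ?subr0//.
exact: ncoefP.
Qed.
Fact nmulDl : left_distributive nmul +%R.
Proof.
move=> a b c; apply: nov_inj => x; rewrite ncoefD.
change (conv (ncoef (a + b)) (ncoef c) x =
        conv (ncoef a) (ncoef c) x + conv (ncoef b) (ncoef c) x).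
have -> : ncoef (a + b) = ncoef a + ncoef b by apply/funext => y; exact: ncoefD.
by rewrite convDl//; exact: ncoefP.
Qed.
Fact nov1_neq0 : none != 0.
Proof.
apply/eqP => /(congr1 (fun a => ncoef a 0)) /=; rewrite /mono eqxx => /eqP.
by rewrite oner_eq0.
Qed.

HB.instance Definition _ := GRing.Zmodule_isComNzRing.Build nov
  nmulA nmulC nmul1 nmulDl nov1_neq0.

Lemma ncoefM (a b : nov) x :
  ncoef (a * b) x = \sum_(y \in [set: R]) ncoef a y * ncoef b (x - y).
Proof. by []. Qed.

Lemma ncoef_mono l c x : ncoef (nmono l c) x = if x == l then c else 0.
Proof. by []. Qed.

Lemma nmono01 : nmono 0 1 = 1. Proof. by []. Qed.

Lemma nmonoM l m c d : nmono l c * nmono m d = nmono (l + m) (c * d).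
Proof.
apply: nov_inj => x; rewrite [LHS]conv_monol; last exact: lfinite_mono.
rewrite ncoef_mono /= /mono subr_eq (addrC m l).
by case: (x =P l + m); rewrite ?mulr0.
Qed.

Lemma nmonoMl l c (a : nov) x : ncoef (nmono l c * a) x = c * ncoef a (x - l).
Proof. by rewrite [LHS]conv_monol//; exact: ncoefP. Qed.

Lemma ncoefM_neq0 (a b : nov) x : ncoef (a * b) x != 0 ->
  exists y z, [/\ ncoef a y != 0, ncoef b z != 0 & y + z = x].
Proof. exact: conv_neq0. Qed.

Lemma ncoefM_local (a b c : nov) x :
  (forall y, y < 0 -> ncoef a y = 0) ->
  (forall y, y <= x -> ncoef b y = ncoef c y) ->
  ncoef (a * b) x = ncoef (a * c) x.
Proof.
move=> a0 bc; rewrite !ncoefM; apply: eq_fsbigr => y _.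
have [y0|y0] := ltP y 0; first by rewrite a0// !mul0r.
by rewrite bc//; lra.
Qed.

Lemma ncoefX_small (u : nov) (d : R) n : 0 < d ->
  (forall y, y < d -> ncoef u y = 0) ->
  forall y, y < d *+ n -> ncoef (u ^+ n) y = 0.
Proof.
move=> d0 ud; elim: n => [|n IH] y yd.
  by rewrite expr0 ncoef_mono; case: eqP => // y0; move: yd; rewrite y0 ltxx.
apply/eqP/negPn/negP; rewrite exprS => /ncoefM_neq0[a [b [ua ub aby]]].
have da : d <= a by rewrite leNgt; apply: contra_neqN ua; exact: ud.
have db : d *+ n <= b by rewrite leNgt; apply: contra_neqN ub; exact: IH.
by move: yd; rewrite mulrS -aby ltNge lerD.
Qed.

Lemma nov_geom (u : nov) (d : R) : 0 < d ->
  (forall y, y < d -> ncoef u y = 0) -> exists g, g * (1 - u) = 1.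
Proof.
move=> d0 ud.
pose N (x : R) := (Num.truncn (x / d)).+1.
have Nlt x : x < d *+ N x.
  by rewrite -[_ *+ _]mulr_natr mulrC -ltr_pdivrMr// Num.Theory.truncnS_gt.
pose S n : nov := \sum_(i < n) u ^+ i.
have SE n x m : x < d *+ n -> ncoef (S (n + m)%N) x = ncoef (S n) x.
  elim: m => [|m IH] xd; first by rewrite addn0.
  rewrite addnS [S _]big_ord_recr ncoefD -/(S _) IH// (ncoefX_small d0 ud) ?addr0//.
  by apply: lt_le_trans xd _; rewrite ler_pMn2l ?leq_addr.
have SE2 n m x : x < d *+ n -> x < d *+ m -> ncoef (S m) x = ncoef (S n) x.
  move=> xn xm; case: (leqP n m) => [nm|/ltnW mn].
    by rewrite -(subnKC nm) SE.
  by rewrite -(subnKC mn) SE.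
have gfin : lfinite (fun x => ncoef (S (N x)) x).
  apply: seq_lfinite => E.
  have [s _ sP] := lfinite_seq E (ncoefP (S (N E))).
  exists s => x gx xE; apply: sP => //.
  by rewrite -(SE2 (N E) (N x))// (le_lt_trans xE).
exists (mkNov gfin); rewrite mulrC; apply: nov_inj => x.
rewrite (@ncoefM_local _ _ (S (N x))).
- rewrite /S -[X in X - u](expr1n _ (N x)).
  have -> : (1 ^+ N x - u) * (\sum_(i < N x) u ^+ i) = 1 - u ^+ N x.
    rewrite -[in RHS](expr1n _ (N x)) subrXX; congr (_ * _).
      by rewrite expr1n.
    by apply: eq_bigr => i _; rewrite expr1n mul1r.
  by rewrite ncoefB (ncoefX_small d0 ud)// subr0.
- move=> y y0; rewrite ncoefB ncoef_mono lt_eqF// ud ?subrr//.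
  exact: lt_trans d0.
- by move=> y yx /=; apply: SE2 => //; exact: le_lt_trans yx _.
Qed.

Lemma nov_min (a : nov) : a != 0 ->
  exists2 v, ncoef a v != 0 & forall y, y < v -> ncoef a y = 0.
Proof.
move=> a0; have [x0 ax0] : exists x, ncoef a x != 0.
  apply: contrapT => /forallNP H; move/eqP: a0; apply; apply: nov_inj => x.
  by have /negP/negPn/eqP := H x.
have [s _ sP] := lfinite_seq x0 (ncoefP a).
pose t := [seq x <- s | ncoef a x != 0].
have [v vt vP] : exists2 v, v \in t & forall x, x \in t -> v <= x.
  have : x0 \in t by rewrite mem_filter ax0 sP.
  elim: t x0 {ax0 sP} => // z t IH x0 _.
  case: t IH => [_|w t IH]; first by exists z; rewrite ?inE// => x; rewrite inE => /eqP->.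
  have [|v vt vP] := IH w; first by rewrite inE eqxx.
  exists (Num.min z v).
    by case: (leP z v) => _; rewrite in_cons ?eqxx// vt orbT.
  move=> x; rewrite in_cons ge_min => /orP[/eqP->|/vP->]; by rewrite ?lexx ?orbT.
move: vt; rewrite mem_filter => /andP[av vs]; exists v => // y yv.
apply/eqP/negPn/negP => ay.
have [yx0|x0y] := leP y x0.
  by have : y \in t by [rewrite mem_filter ay sP]; move/vP; rewrite leNgt yv.
have : x0 \in t by rewrite mem_filter ax0 sP.
by move/vP; rewrite leNgt (lt_trans x0y yv).
Qed.

Lemma nov_inv (a : nov) : a != 0 -> exists b, b * a = 1.
Proof.
move=> /nov_min[v av avP].
pose u : nov := 1 - nmono (- v) (ncoef a v)^-1 * a.
have uE y : ncoef u y = (y == 0)%:R - (ncoef a v)^-1 * ncoef a (y + v).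
  by rewrite ncoefB nmonoMl opprK ncoef_mono; case: (y == 0).
have u0 y : y <= 0 -> ncoef u y = 0.
  rewrite uE le_eqVlt => /orP[/eqP->|y0].
    by rewrite add0r eqxx mulVf ?subrr.
  have yv : y + v < v by rewrite gtrDr.
  by rewrite (lt_eqF y0) (avP _ yv) mulr0 subr0.
have [d d0 ud] : exists2 d, 0 < d & forall y, y < d -> ncoef u y = 0.
  have [u00|un0] := eqVneq u 0; first by exists 1 => // y _; rewrite u00.
  have [w uw wP] := nov_min un0; exists w => //.
  by rewrite ltNge; apply: contra_neqN uw; exact: u0.
have [g gu] := nov_geom d0 ud.
exists (g * nmono (- v) (ncoef a v)^-1); rewrite -mulrA -gu; congr (_ * _).
by rewrite /u opprB addrC subrK.
Qed.

Let ninv (a : nov) : nov :=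
  if pselect (exists b, b * a = 1) is left h then sval (cid h) else 0.

Fact nmulVf (a : nov) : a != 0 -> ninv a * a = 1.
Proof.
move=> a0; rewrite /ninv; case: pselect => [h|]; first by case: (cid h).
by have := nov_inv a0.
Qed.
Fact ninv0 : ninv 0 = 0.
Proof.
rewrite /ninv; case: pselect => // h; have [b] := h.
by rewrite mulr0 => /esym/eqP; rewrite oner_eq0.
Qed.

HB.instance Definition _ := GRing.ComNzRing_isField.Build nov nmulVf ninv0.

End NovikovField.

(******************************************************************************)
(* Conventions.                                                               *)
(* - Finite-dimensional (graded) vector spaces are given by homogeneous       *)
(*   bases: a vector is a row of coordinates, a multilinear map is its table  *)
(*   of values on basis vectors, and extension of scalars from C to the       *)
(*   Novikov field acts on coordinates.                                       *)
(* - Z/2-degrees are booleans (true = odd) and sgn b = (-1)^b; the reduced    *)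
(*   degree |x|' = |x| - 1 is the negation of |x|.                            *)
(* - The geometric objects that are constructed by transcendental means       *)
(*   (Gromov-Witten invariants, the disk operators, the Fukaya category, the  *)
(*   open-closed maps) are carried by records whose fields are the properties *)
(*   these objects are known or assumed to have.                              *)
(******************************************************************************)

Notation Lam R := (novikov R R[i]).

Definition ncst (R : realType) (c : R[i]) : Lam R := nmono 0 c.
Definition Tpow (R : realType) (l : R) : Lam R := nmono l 1.

(* T-adic unconditional convergence of \sum_i x i to a *)
Definition nov_sums (R : realType) (I : eqType) (x : I -> Lam R) (a : Lam R) :=
  forall E : R, exists F : seq I, forall G : seq I,
    uniq G -> {subset F <= G} ->
    forall t, t <= E -> ncoef (a - \sum_(i <- G) x i) t = 0.

Definition nov_sums_mx (R : realType) (I : eqType) (d : nat)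
    (x : I -> 'rV[Lam R]_d) (v : 'rV[Lam R]_d) :=
  forall k, nov_sums (fun i => x i 0 k) (v 0 k).

Definition sgn (K : pzRingType) (b : bool) : K := (-1) ^+ b.
Arguments sgn {K} b.

Definition bvec (K : pzRingType) (d : nat) (i : 'I_d) : 'rV[K]_d := delta_mx 0 i.
Arguments bvec {K d} i.

Definition bilin (K : pzRingType) (d1 d2 d3 : nat)
    (c : 'I_d1 -> 'I_d2 -> 'rV[K]_d3) (x : 'rV[K]_d1) (y : 'rV[K]_d2) : 'rV[K]_d3 :=
  \sum_i \sum_j (x 0 i * y 0 j) *: c i j.

Definition bilin_form (K : pzRingType) (d1 d2 : nat)
    (P : 'I_d1 -> 'I_d2 -> K) (x : 'rV[K]_d1) (y : 'rV[K]_d2) : K :=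
  \sum_i \sum_j x 0 i * y 0 j * P i j.

(* equality of coordinates of vectors whose dimensions agree only propositionally *)
Definition same_coord (K : Type) (d1 d2 : nat) (v : 'rV[K]_d1) (w : 'rV[K]_d2) :=
  d1 = d2 /\ forall (i : 'I_d1) (j : 'I_d2), i = j :> nat -> v 0 i = w 0 j.

(******************************************************************************)
(* Topology                                                                   *)
(******************************************************************************)

Record gspace := GSpace { gdim : nat; gdeg : 'I_gdim -> nat }.

(* The cohomology ring of a closed oriented manifold of dimension N. *)
Record cohring (K : fieldType) (N : nat) := CohRing {
  coh :> gspace;
  cup : 'I_(gdim coh) -> 'I_(gdim coh) -> 'rV[K]_(gdim coh);
  coh1 : 'rV[K]_(gdim coh);
  integral : 'I_(gdim coh) -> K;
  gdeg_le : forall i : 'I_(gdim coh), (gdeg i <= N)%N;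
  cup_deg : forall i j k, cup i j 0 k != 0 -> gdeg k = (gdeg i + gdeg j)%N;
  coh1_deg : forall i, coh1 0 i != 0 -> gdeg i = 0%N;
  integral_deg : forall i, integral i != 0 -> gdeg i = N;
  cupA : forall x y z, bilin cup x (bilin cup y z) = bilin cup (bilin cup x y) z;
  cup1x : forall x, bilin cup coh1 x = x;
  cupC : forall i j, cup i j = sgn (odd (gdeg i * gdeg j)) *: cup j i;
  poincare_duality : forall x : 'rV[K]_(gdim coh),
    (forall j, \sum_i x 0 i * (\sum_k cup i j 0 k * integral k) = 0) -> x = 0
}.

(* int x \cup y on basis vectors *)
Definition ipair (K : fieldType) (N : nat) (H : cohring K N)
    (i j : 'I_(gdim H)) : K := \sum_k cup i j 0 k * integral k.

Definition intersection (R : realType) (N : nat) (H : cohring R[i] N) :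
    'rV[Lam R]_(gdim H) -> 'rV[Lam R]_(gdim H) -> Lam R :=
  bilin_form (fun i j => ncst (ipair i j)).

(* A closed symplectic manifold X of dimension 2n: its points, cohomology     *)
(* ring, H_2(X;Z), the periods of omega, the first Chern class and the        *)
(* genus-0 three-point Gromov-Witten invariants.                              *)
Record symplectic (R : realType) (n : nat) := Symplectic {
  pointX : Type;
  HX : cohring R[i] (2 * n);
  H2X : zmodType;
  omegaX : {additive H2X -> R};
  evX : 'I_(gdim HX) -> {additive H2X -> R[i]};
  evX_deg : forall i a, evX i a != 0 -> gdeg i = 2%N;
  evX_inj : forall x : 'rV[R[i]]_(gdim HX),
    (forall i, x 0 i != 0 -> gdeg i = 2%N) ->
    (forall a, \sum_i x 0 i * evX i a = 0) -> x = 0;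
  evX_surj : forall f : {additive H2X -> R[i]}, exists x : 'rV[R[i]]_(gdim HX),
    (forall i, x 0 i != 0 -> gdeg i = 2%N) /\
    (forall a, \sum_i x 0 i * evX i a = f a);
  c1 : 'rV[R[i]]_(gdim HX);
  c1_deg : forall i, c1 0 i != 0 -> gdeg i = 2%N;
  c1Z : {additive H2X -> int};
  c1ZE : forall a, \sum_i c1 0 i * evX i a = (c1Z a)%:~R;
  GW3 : H2X -> 'I_(gdim HX) -> 'I_(gdim HX) -> 'I_(gdim HX) -> R[i];
  GW3_deg : forall a i j k, GW3 a i j k != 0 ->
    (gdeg i + gdeg j + gdeg k)%N%:Z = (2 * n)%N%:Z + 2 * c1Z a;
  GW3_sym12 : forall a i j k,
    GW3 a i j k = sgn (odd (gdeg i * gdeg j)) * GW3 a j i k;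
  GW3_sym23 : forall a i j k,
    GW3 a i j k = sgn (odd (gdeg j * gdeg k)) * GW3 a i k j;
  GW3_0 : forall i j k, GW3 0 i j k = \sum_l cup i j 0 l * ipair l k;
  GW3_unit : forall a j k, a != 0 -> \sum_i coh1 HX 0 i * GW3 a i j k = 0;
  GW3_energy : forall a i j k, GW3 a i j k != 0 -> a != 0 -> 0 < omegaX a;
  GW3_compact : forall E : R,
    finite_set [set a | omegaX a <= E /\ exists i j k, GW3 a i j k != 0];
  (* the quantum product e_i * e_j *)
  qprod : 'I_(gdim HX) -> 'I_(gdim HX) -> 'rV[Lam R]_(gdim HX);
  qprodE : forall i j k,
    nov_sums (fun a => Tpow (omegaX a / (2 * pi)) * ncst (GW3 a i j k))
             (intersection (qprod i j) (bvec k));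
  qprodA : forall x y z,
    bilin qprod x (bilin qprod y z) = bilin qprod (bilin qprod x y) z;
  qprod1x : forall x, bilin qprod (map_mx (@ncst R) (coh1 HX)) x = x;
  qprodx1 : forall x, bilin qprod x (map_mx (@ncst R) (coh1 HX)) = x
}.

Section QuantumCohomology.
Variables (R : realType) (n : nat) (X : symplectic R n).

Definition QH := 'rV[Lam R]_(gdim (HX X)).
Definition qmul (x y : QH) : QH := bilin (@qprod _ _ X) x y.
Definition toQH (x : 'rV[R[i]]_(gdim (HX X))) : QH := map_mx (@ncst R) x.

(* The ring QH e is isomorphic, as a Lam-algebra with unit e, to Lam. *)
Definition ideal_isom_Lam (e : QH) := exists g : Lam R -> QH,
  [/\ forall a b c, g (a * b + c) = a *: g b + g c,
      forall a b, g (a * b) = qmul (g a) (g b),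
      g 1 = e,
      injective g &
      forall y, (exists a, y = g a) <-> (exists x, y = qmul x e)].

End QuantumCohomology.

(* C-multilinear operations, given on basis vectors, extended to Lam *)
Fixpoint mext (R : realType) (d d' : nat) (f : seq 'I_d -> 'rV[R[i]]_d')
    (xs : seq 'rV[Lam R]_d) : 'rV[Lam R]_d' :=
  if xs is x :: xs' then \sum_i x 0 i *: mext (fun s => f (i :: s)) xs'
  else map_mx (@ncst R) (f [::]).

(* |x_1|' + ... + |x_s|' *)
Definition red_sum (V : gspace) (s : seq 'I_(gdim V)) : bool :=
  odd (\sum_(i <- s) (gdeg i).+1).

(* (-1)^(|x||y| + |x|) int x \cup y *)
Definition cyc_coh (K : fieldType) (N : nat) (H : cohring K N)
    (i j : 'I_(gdim H)) : K :=
  sgn (odd (gdeg i * gdeg j + gdeg i)) * ipair i j.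

(* A closed oriented spin Lagrangian L in X together with its disk operators. *)
(* Since C^* is abelian, a character of pi_1(L) is one of H_1(L;Z).           *)
Record lagrangian (R : realType) (n : nat) (X : symplectic R n) := Lagrangian {
  Lset : set (pointX X);
  HL : cohring R[i] n;
  restr : 'I_(gdim (HX X)) -> 'rV[R[i]]_(gdim HL);
  restr_deg : forall i k, restr i 0 k != 0 -> gdeg k = gdeg i;
  restr1 : \sum_i coh1 (HX X) 0 i *: restr i = coh1 HL;
  restrM : forall i j,
    \sum_k cup i j 0 k *: restr k = bilin (@cup _ _ HL) (restr i) (restr j);
  (* the Poincare dual [L] *)
  fundL : 'rV[R[i]]_(gdim (HX X));
  fundLE : forall i, \sum_k restr i 0 k * integral k = \sum_j fundL 0 j * ipair j i;
  H1L : zmodType;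
  H2L : zmodType;                               (* H_2(X, L; Z) *)
  relL : {additive H2X X -> H2L};
  bdL : {additive H2L -> H1L};
  exactL : forall b, bdL b = 0 <-> exists a, b = relL a;
  omegaL : {additive H2L -> R};
  omegaL_rel : forall a, omegaL (relL a) = omegaX X a;
  (* the Maslov class: even as L is oriented, and a lift of 2 c_1 *)
  maslov : {additive H2L -> int};
  maslov_even : forall b, exists z : int, maslov b = 2 * z;
  maslov_rel : forall a, maslov (relL a) = 2 * c1Z X a;
  (* H^*(L; flat line bundle of monodromy rho) *)
  Hloc : (H1L -> R[i]) -> gspace;
  Hloc_triv : Hloc (fun _ => 1) = HL;
  (* the moduli space of stable disks of class b with k boundary marked points *)
  disks : nat -> H2L -> Type;
  disks_energy : forall k b, inhabited (disks k b) -> b != 0 -> 0 < omegaL b;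
  disks_compact : forall E : R,
    finite_set [set b | omegaL b <= E /\ exists k, inhabited (disks k b)];
  (* m_{s,b}(x_1, ..., x_s), s being the length of the argument list *)
  mdisk : H2L -> seq 'I_(gdim HL) -> 'rV[R[i]]_(gdim HL);
  mdisk_deg : forall b s k, mdisk b s 0 k != 0 ->
    (gdeg k)%:Z = (\sum_(i <- s) gdeg i)%N%:Z + 2 - (size s)%:Z - maslov b;
  mdisk_supp : forall b s, mdisk b s != 0 ->
    exists bs : seq H2L, [/\ (0 < size bs)%N, b = \sum_(b' <- bs) b' &
      forall j, (j < size bs)%N -> inhabited (disks (size s).+1 (nth 0 bs j))];
  mdisk_00 : mdisk 0 [::] = 0;
  mdisk_10 : forall i, mdisk 0 [:: i] = 0;
  mdisk_20 : forall i j,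
    mdisk 0 [:: i; j] = sgn (odd (gdeg i * gdeg j + gdeg i)) *: cup i j;
  mdisk_ainf : forall b s,
    \sum_(b2 \in [set: H2L])
      \sum_(i < (size s).+1) \sum_(l < (size s - i).+1)
        sgn (red_sum (take i s)) *:
          \sum_k mdisk b2 (take l (drop i s)) 0 k *:
            mdisk (b - b2) (take i s ++ k :: drop (i + l) s) = 0;
  mdisk_unit : forall b s t, b != 0 \/ (3 <= size s + 1 + size t)%N ->
    \sum_k coh1 HL 0 k *: mdisk b (s ++ k :: t) = 0;
  mdisk_cyc : forall b x0 s xs,
    \sum_k mdisk b (rcons s xs) 0 k * cyc_coh k x0 =
    sgn (~~ odd (gdeg x0) && red_sum (rcons s xs)) *
      \sum_k mdisk b (x0 :: s) 0 k * cyc_coh k xs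
}.

(* A Maurer-Cartan element b = (rho, b_+) of L, with its potential W_{L,b}. *)
Record mcelt (R : realType) (n : nat) (X : symplectic R n) (L : lagrangian X) :=
  MCElt {
  rho : H1L L -> R[i];
  rho0 : rho 0 = 1;
  rhoD : forall x y, rho (x + y) = rho x * rho y;
  bplus : 'rV[Lam R]_(gdim (HL L));
  bplus_odd : forall i, bplus 0 i != 0 -> odd (gdeg i);
  bplus_gt0 : forall i t, t <= 0 -> ncoef (bplus 0 i) t = 0;
  potential : Lam R;
  mc_eq : nov_sums_mx
    (fun sb : nat * H2L L =>
       (ncst (rho (bdL L sb.2)) * Tpow (omegaL L sb.2 / (2 * pi))) *:
         mext (@mdisk _ _ _ L sb.2) (nseq sb.1 bplus))
    (potential *: map_mx (@ncst R) (coh1 (HL L)))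
}.

(* dim H^k(L;C) = dim H^k(S^n;C) for all k *)
Definition rational_homology_sphere (R : realType) (n : nat) (X : symplectic R n)
    (L : lagrangian X) :=
  forall k : nat,
    #|[pred i : 'I_(gdim (HL L)) | gdeg i == k]| = ((k == 0) + (k == n))%N.

(******************************************************************************)
(* A-infinity categories and Hochschild theory                                *)
(******************************************************************************)

(* objects and homogeneous bases of the finite-dimensional hom spaces *)
Record quiver := Quiver {
  ob :> Type;
  hdim : ob -> ob -> nat;
  hpar : forall A B, 'I_(hdim A B) -> bool
}.

(* basis elements x_1[x_2|...|x_s] of hom(A_0,A_1) (x) ... (x) hom(A_{s-1},A_s) *)
Inductive word (Q : quiver) (A : Q) : Q -> Type :=
| wnil : word A A
| wsnoc B C (p : word A B) (i : 'I_(hdim B C)) : word A C.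
Arguments wnil {Q} A.
Arguments wsnoc {Q A B C} p i.

Fixpoint wcat (Q : quiver) (A B C : Q) (p : word A B) (q : word B C) : word A C :=
  match q with
  | wnil => p
  | wsnoc _ _ q' i => wsnoc (wcat p q') i
  end.

Fixpoint wlen (Q : quiver) (A B : Q) (p : word A B) : nat :=
  if p is wsnoc _ _ p' _ then (wlen p').+1 else 0%N.

(* |x_1|' + ... + |x_s|' *)
Fixpoint wpar (Q : quiver) (A B : Q) (p : word A B) : bool :=
  if p is wsnoc _ _ p' i then wpar p' (+) ~~ hpar i else false.

Record wsplit (Q : quiver) (A B : Q) := Split {
  smid : Q; sleft : word A smid; sright : word smid B
}.

(* all the factorizations p = p1 p2 *)
Fixpoint splits (Q : quiver) (A B : Q) (p : word A B) : seq (wsplit A B) :=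
  match p with
  | wnil => [:: Split (wnil A) (wnil A)]
  | wsnoc _ _ p' i =>
      rcons [seq Split (sleft s) (wsnoc (sright s) i) | s <- splits p']
            (Split (wsnoc p' i) (wnil _))
  end.

Section Cochains.
Variables (K : fieldType) (Q : quiver).

Definition cochain := forall A B : Q, word A B -> 'rV[K]_(hdim A B).

Implicit Types phi psi : cochain.

(* phi(p, v, q) *)
Definition ins phi (A B C D : Q) (p : word A B) (v : 'rV[K]_(hdim B C))
    (q : word C D) : 'rV[K]_(hdim A D) :=
  \sum_k v 0 k *: phi _ _ (wcat (wsnoc p k) q).

(* phi(p, v, q, w, r) *)
Definition ins2 phi (A B C D E F : Q) (p : word A B) (v : 'rV[K]_(hdim B C))
    (q : word C D) (w : 'rV[K]_(hdim D E)) (r : word E F) : 'rV[K]_(hdim A F) :=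
  \sum_k v 0 k *: ins phi (wcat (wsnoc p k) q) w r.

Definition cochain_par (a : bool) phi :=
  forall (A B : Q) (p : word A B) k, phi _ _ p 0 k != 0 -> hpar k = a (+) wpar p.

End Cochains.

(* n-cyclic strictly unital A-infinity categories *)
Record ainf_cat (K : fieldType) (n : nat) (Q : quiver) := AInfCat {
  am : cochain K Q;
  am_nil : forall A, am (wnil A) = 0;
  am_par : cochain_par false am;
  am_ainf : forall (A B : Q) (p : word A B),
    \sum_(s <- splits p) \sum_(t <- splits (sright s))
      sgn (wpar (sleft s)) *: ins am (sleft s) (am (sleft t)) (sright t) = 0;
  aunit : forall A : Q, 'rV[K]_(hdim A A);
  aunit_par : forall A k, aunit A 0 k != 0 -> hpar k = false;
  aunit_l : forall (A B : Q) (i : 'I_(hdim A B)),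
    ins am (wnil A) (aunit A) (wsnoc (wnil A) i) = bvec i;
  aunit_r : forall (A B : Q) (i : 'I_(hdim A B)),
    ins am (wsnoc (wnil A) i) (aunit B) (wnil B) = sgn (hpar i) *: bvec i;
  aunit_high : forall (A B C : Q) (p : word A B) (q : word B C),
    (wlen p + wlen q)%N <> 1%N -> ins am p (aunit B) q = 0;
  acyc : forall A B : Q, 'M[K]_(hdim A B, hdim B A);
  acyc_par : forall (A B : Q) i j,
    acyc A B i j != 0 -> hpar i (+) hpar j = odd n;
  acyc_nondegl : forall A B, row_free (acyc A B);
  acyc_nondegr : forall A B, row_free (acyc A B)^T;
  (* <m(p, i), j> = (-1)^(|j|' (|p|' + |i|')) <m(j, p), i> *)
  acyc_cyc : forall (A B C : Q) (p : word A B) (i : 'I_(hdim B C)) (j : 'I_(hdim C A)),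
    \sum_k am (wsnoc p i) 0 k * acyc A C k j =
    sgn (~~ hpar j && wpar (wsnoc p i)) *
      \sum_k am (wcat (wsnoc (wnil C) j) p) 0 k * acyc C B k i
}.

Section Hochschild.
Variables (K : fieldType) (n : nat) (Q : quiver) (F : ainf_cat K n Q).
Local Notation m := (am F).

Definition m1 (A B : Q) : 'M[K]_(hdim A B) :=
  \matrix_(i, j) m (wsnoc (wnil A) i) 0 j.

Definition hclosed (A B : Q) (x : 'rV[K]_(hdim A B)) := x *m m1 A B = 0.
Definition exact_el (A B : Q) (x : 'rV[K]_(hdim A B)) :=
  exists y, x = y *m m1 A B.

(* x . y = (-1)^(|x||y| + |x|) m_2(x, y) *)
Definition hprod (A B C : Q) (x : 'rV[K]_(hdim A B)) (y : 'rV[K]_(hdim B C)) :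
    'rV[K]_(hdim A C) :=
  bilin (fun i j => sgn ((hpar i && hpar j) (+) hpar i) *:
                      m (wsnoc (wsnoc (wnil A) i) j)) x y.

(* The cohomology ring of hom(A,A) is isomorphic to S; f is the composite of  *)
(* the projection from cocycles to cohomology with the isomorphism.           *)
Definition HF_isom (A : Q) (S : pzRingType) :=
  exists f : 'rV[K]_(hdim A A) -> S,
    [/\ forall x y, hclosed x -> hclosed y -> f (x + y) = f x + f y,
        forall x y, hclosed x -> hclosed y -> f (hprod x y) = f x * f y,
        f (aunit F A) = 1,
        forall x, hclosed x -> (f x = 0 <-> exact_el x) &
        forall s, exists2 x, hclosed x & f x = s].

(* [m, phi] for phi of degree a *)
Definition hdiff (a : bool) (phi : cochain K Q) : cochain K Q :=
  fun A B p => \sum_(s <- splits p) \sum_(t <- splits (sright s))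
    (sgn (~~ a && wpar (sleft s)) *:
       ins m (sleft s) (phi _ _ (sleft t)) (sright t)
     + sgn (a (+) wpar (sleft s)) *:
       ins phi (sleft s) (m (sleft t)) (sright t)).

(* phi and psi, of degree a, differ by a coboundary *)
Definition cohomologous (a : bool) (phi psi : cochain K Q) :=
  exists2 theta : cochain K Q, cochain_par (~~ a) theta &
    forall (A B : Q) (p : word A B),
      phi _ _ p = psi _ _ p + hdiff (~~ a) theta p.

(* The cup product (-1)^(|phi||psi| + |phi|) M_2(phi, psi), for phi, psi of   *)
(* degrees a, b.                                                              *)
Definition hcup (a b : bool) (phi psi : cochain K Q) : cochain K Q :=
  fun A B p => sgn ((a && b) (+) a) *:
    \sum_(s1 <- splits p) \sum_(s2 <- splits (sright s1))
    \sum_(s3 <- splits (sright s2)) \sum_(s4 <- splits (sright s3))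
      sgn ((~~ a && wpar (sleft s1)) (+)
           (~~ b && (wpar (sleft s1) (+) wpar (sleft s2) (+) wpar (sleft s3)))) *:
      ins2 m (sleft s1) (phi _ _ (sleft s2)) (sleft s3)
             (psi _ _ (sleft s4)) (sright s4).

Definition hone : cochain K Q :=
  fun A B p => match p in word _ B return 'rV[K]_(hdim A B) with
               | wnil => aunit F A
               | _ => 0
               end.

(* the basis element x_0[x_1|...|x_s] of the Hochschild chains *)
Record hgen := HGen {
  hsrc : Q; htgt : Q; hword : word hsrc htgt; hfirst : 'I_(hdim htgt hsrc)
}.

Definition gpar (g : hgen) : bool := hpar (hfirst g) (+) wpar (hword g).

(* formal finite linear combinations of basis elements *)
Definition hchain := seq (K * hgen).

Definition chain_par (a : bool) (X : hchain) := all (fun c => gpar c.2 == a) X.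

(* X = 0 in the vector space of chains *)
Definition chain_zero (X : hchain) :=
  forall f : hgen -> K, \sum_(c <- X) c.1 * f c.2 = 0.

(* b(x_0[x_1|...|x_s]) =                                                      *)
(*   \sum (-1)^(|x_0|' + |p1|') x_0[p1|m(p2)|p3]                              *)
(*   + \sum (-1)^(|p3|' (|x_0|' + |p1|' + |p2|')) m(p3, x_0, p1)[p2]          *)
(* over x_1 ... x_s = p1 p2 p3                                                *)
Definition hb_gen (g : hgen) : hchain :=
  flatten [seq flatten [seq
    [seq (sgn (~~ hpar (hfirst g) (+) wpar (sleft s)) * m (sleft t) 0 k,
          HGen (wcat (wsnoc (sleft s) k) (sright t)) (hfirst g))
       | k <- enum 'I_(hdim (smid s) (smid t))]
    ++
    [seq (sgn (wpar (sright t) &&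
               (~~ hpar (hfirst g) (+) wpar (sleft s) (+) wpar (sleft t))) *
          m (wcat (wsnoc (sright t) (hfirst g)) (sleft s)) 0 k,
          HGen (sleft t) k)
       | k <- enum 'I_(hdim (smid t) (smid s))]
    | t <- splits (sright s)] | s <- splits (hword g)].

Definition hb (X : hchain) : hchain :=
  flatten [seq [seq (c.1 * d.1, d.2) | d <- hb_gen c.2] | c <- X].

Definition hcycle (X : hchain) := chain_zero (hb X).

(* the chain x[] of length 0 *)
Definition len0 (A : Q) (x : 'rV[K]_(hdim A A)) : hchain :=
  [seq (x 0 k, HGen (wnil A) k) | k <- enum 'I_(hdim A A)].

(* <phi, x_0[x_1|...|x_s]>_cyc *)
Definition cyc_gen (phi : cochain K Q) (g : hgen) : K :=
  sgn (~~ hpar (hfirst g) && wpar (hword g)) *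
    \sum_k phi _ _ (hword g) 0 k * acyc F (hsrc g) (htgt g) k (hfirst g).

Definition chain_form (muk : hgen -> hgen -> K) (X Y : hchain) : K :=
  \sum_(c <- X) \sum_(d <- Y) c.1 * d.1 * muk c.2 d.2.

Definition el_par (a : bool) (A B : Q) (x : 'rV[K]_(hdim A B)) :=
  forall k, x 0 k != 0 -> hpar k = a.

(* The rows of H are homogeneous cocycles, of degrees e, and their classes    *)
(* form a basis of H^* hom(A,B).                                              *)
Definition cohom_basis (A B : Q) (k : nat) (H : 'M[K]_(k, hdim A B))
    (e : 'I_k -> bool) :=
  [/\ forall i, hclosed (row i H) /\ el_par (e i) (row i H),
      forall x : 'rV[K]_(hdim A B), hclosed x ->
        exists c : 'rV[K]_k, exact_el (x - c *m H) &
      forall c : 'rV[K]_k, exact_el (c *m H) -> c = 0].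

(* t is the supertrace of the endomorphism of H^* hom(A,B) induced by the     *)
(* linear map equal to f e on elements of degree e.                           *)
Definition is_supertrace (A B : Q)
    (f : bool -> 'rV[K]_(hdim A B) -> 'rV[K]_(hdim A B)) (t : K) :=
  forall (k : nat) (H : 'M[K]_(k, hdim A B)) (e : 'I_k -> bool) (M : 'M[K]_k),
    cohom_basis H e ->
    (forall i, exact_el (f (e i) (row i H) - row i M *m H)) ->
    t = \sum_i sgn (e i) * M i i.

End Hochschild.

(******************************************************************************)
(* The Fukaya category and the open-closed maps                               *)
(******************************************************************************)

Section Fukaya.
Variables (R : realType) (n : nat) (X : symplectic R n).
Variables (I : finType) (L : I -> lagrangian X).

Definition fobj := {l : I & mcelt (L l)}.
Definition FObj (l : I) (b : mcelt (L l)) : fobj := existT _ l b.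
Definition fpot (A : fobj) : Lam R := potential (projT2 A).

(* p is a word in hom spaces between objects (L_l, (r, b_{i,+})) of potential *)
(* w; b0 is b_{0,+} and the entries of t are the pairs (x_i, b_{i,+}), i > 0. *)
Inductive word_over (hd : fobj -> fobj -> nat)
    (hp : forall A B, 'I_(hd A B) -> bool) (l : I) (r : H1L (L l) -> R[i])
    (w : Lam R) :
  forall A B : Quiver hp, word A B -> 'rV[Lam R]_(gdim (HL (L l))) ->
    seq ('I_(gdim (HL (L l))) * 'rV[Lam R]_(gdim (HL (L l)))) -> Prop :=
| over_nil (b : mcelt (L l)) of rho b = r & potential b = w :
    word_over r w (wnil (FObj b : Quiver hp)) (bplus b) [::]
| over_snoc A (b b' : mcelt (L l)) (p : word A (FObj b : Quiver hp))
    (i : 'I_(hd (FObj b) (FObj b'))) (j : 'I_(gdim (HL (L l)))) b0 t of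
    word_over r w p b0 t & rho b' = r & potential b' = w & i = j :> nat :
    word_over r w (wsnoc p (i : 'I_(@hdim (Quiver hp) (FObj b) (FObj b')))) b0
              (rcons t (j, bplus b')).

(* b_0^{l_0}, x_1, b_1^{l_1}, ..., x_s, b_s^{l_s} *)
Fixpoint weave (d : nat) (ls : seq nat) (b0 : 'rV[Lam R]_d)
    (t : seq ('I_d * 'rV[Lam R]_d)) : seq 'rV[Lam R]_d :=
  nseq (head 0%N ls) b0 ++
  (if t is (j, b) :: t' then bvec j :: weave (behead ls) b t' else [::]).

Record fukaya := Fukaya {
  (* the collection of Lagrangians *)
  lag_inj : forall l l', Lset (L l) = Lset (L l') -> l = l';
  lag_unobstructed : forall l, inhabited (mcelt (L l));
  (* the hom spaces *)
  fhdim : fobj -> fobj -> nat;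
  fhpar : forall A B, 'I_(fhdim A B) -> bool;
  fcat : ainf_cat (Lam R) n (Quiver fhpar);
  fhom0 : forall A B, fpot A <> fpot B -> fhdim A B = 0%N;
  fhom_inter : forall A B, fpot A = fpot B -> projT1 A <> projT1 B ->
    exists2 pt : 'I_(fhdim A B) -> pointX X, injective pt &
      range pt = Lset (L (projT1 A)) `&` Lset (L (projT1 B));
  fhom_self : forall l (b b' : mcelt (L l)), potential b = potential b' ->
    let V := Hloc (fun g : H1L (L l) => rho b' g / rho b g) in
    fhdim (FObj b) (FObj b') = gdim V /\
    forall (i : 'I_(fhdim (FObj b) (FObj b'))) (j : 'I_(gdim V)),
      i = j :> nat -> fhpar i = odd (gdeg j);
  (* operations, units and pairings on objects with the same L, rho and W; the *)
  (* i-th basis vector of hom is the i-th basis vector of H^*(L)               *)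
  fm_self : forall l (r : H1L (L l) -> R[i]) (w : Lam R)
      (A B : Quiver fhpar) (p : word A B) b0 t,
    word_over r w p b0 t -> (0 < wlen p)%N ->
    exists2 v : 'rV[Lam R]_(gdim (HL (L l))), same_coord (am fcat p) v &
      nov_sums_mx
        (fun lb : (size t).+1.-tuple nat * H2L (L l) =>
          (ncst (r (bdL (L l) lb.2)) * Tpow (omegaL (L l) lb.2 / (2 * pi))) *:
            mext (@mdisk _ _ _ (L l) lb.2) (weave lb.1 b0 t)) v;
  fcyc_self : forall l (b b' : mcelt (L l)), rho b = rho b' ->
    potential b = potential b' ->
    forall (i : 'I_(fhdim (FObj b) (FObj b'))) (i' : 'I_(fhdim (FObj b') (FObj b)))
           (j j' : 'I_(gdim (HL (L l)))),
      i = j :> nat -> i' = j' :> nat ->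
      acyc fcat (FObj b) (FObj b') i i' = ncst (cyc_coh j j');
  funit_self : forall l (b : mcelt (L l)),
    same_coord (aunit fcat (FObj b)) (map_mx (@ncst R) (coh1 (HL (L l))))
}.

Variable Fk : fukaya.
Local Notation Q := (Quiver (@fhpar Fk)).
Local Notation cat := (fcat Fk).

Record open_closed := OpenClosed {
  (* q on the basis of H^*(X), by representing cocycles *)
  qmap : 'I_(gdim (HX X)) -> cochain (Lam R) Q;
  qmap_par : forall i, cochain_par (odd (gdeg i)) (qmap i);
  qmap_closed : forall i A B (p : word A B),
    hdiff cat (odd (gdeg i)) (qmap i) p = 0;
  qext := fun (x : QH X) A B (p : word A B) =>
    \sum_i x 0 i *: qmap i p : 'rV[Lam R]_(@hdim Q A B);
  qmap1 : cohomologous cat false (qext (toQH (coh1 (HX X)))) (hone cat);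
  qmapM : forall i j,
    cohomologous cat (odd (gdeg i + gdeg j)) (qext (@qprod _ _ X i j))
      (hcup cat (odd (gdeg i)) (odd (gdeg j)) (qmap i) (qmap j));
  (* H^2_c(X \ L; C) = H^2(X, L; C) = Hom(H_2(X, L; Z), C); x is the image of  *)
  (* eta in H^2(X; C)                                                          *)
  qmap_rel : forall l (b : mcelt (L l)) (eta : {additive H2L (L l) -> R[i]})
      (x : 'rV[R[i]]_(gdim (HX X))),
    (forall i, x 0 i != 0 -> gdeg i = 2%N) ->
    (forall a, \sum_i x 0 i * evX i a = eta (relL (L l) a)) ->
    exists v u, [/\
      nov_sums_mx
        (fun sb : nat * H2L (L l) =>
          (ncst (eta sb.2 * rho b (bdL (L l) sb.2)) *
             Tpow (omegaL (L l) sb.2 / (2 * pi))) *: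
            mext (@mdisk _ _ _ (L l) sb.2) (nseq sb.1 (bplus b))) v,
      same_coord u v &
      exact_el cat (qext (toQH x) (wnil (FObj b : Q)) - u)];
  (* p and the Mukai pairing on the basis of Hochschild chains *)
  pmap : hgen Q -> QH X;
  pmapE : forall i g, intersection (bvec i) (pmap g) =
    sgn (odd n && gpar g) * cyc_gen cat (qmap i) g;
  pext := fun (c : hchain (Lam R) Q) => \sum_(d <- c) d.1 *: pmap d.2 : QH X;
  mukai : hgen Q -> hgen Q -> Lam R;
  mukai_bl : forall c d, hcycle cat d -> chain_form mukai (hb cat c) d = 0;
  mukai_br : forall c d, hcycle cat c -> chain_form mukai c (hb cat d) = 0;
  mukai_len0 : forall (A A' : Q) a a'
      (x0 : 'rV[Lam R]_(hdim A A)) (x0' : 'rV[Lam R]_(hdim A' A')),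
    hclosed cat x0 -> hclosed cat x0' -> el_par a x0 -> el_par a' x0' ->
    is_supertrace cat
      (fun (e : bool) (x : 'rV[Lam R]_(hdim A A')) =>
         sgn ((a && e) (+) (a && a')) *: hprod cat (hprod cat x0 x) x0')
      (chain_form mukai (len0 x0) (len0 x0'));
  cardy_sign : bool -> bool -> bool;
  cardy : forall a c d, hcycle cat c -> hcycle cat d -> chain_par a c ->
    intersection (pext c) (pext d) =
    (-1) ^+ (n * n.+1)./2 * sgn (cardy_sign (odd n) a) * chain_form mukai c d;
  pmap1 : forall l (b : mcelt (L l)),
    pext (len0 (aunit cat (FObj b))) = toQH (fundL (L l))
}.

End Fukaya.

(* Main.v *)
Require Import Defs.
From HB Require Import structures.
From mathcomp Require Import all_boot all_order all_algebra.
From mathcomp Require Import all_classical all_reals trigo.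
From mathcomp Require Import complex.

(** Let A = (L, 0). As L is a rational homology sphere of even dimension,
hom(A, A) = H^*(L) has dimension 2 and is concentrated in even degree. Hence
m_1 = 0 on it, so that HF^*(L, 0) is hom(A, A) with the product m_2, and an
isomorphism with Lam x Lam, even one of rings only, yields two nonzero
orthogonal idempotents e1, e2 which by dimension span hom(A, A)
([idempotent_pair_span]).

Two maps relate this algebra to QH. The length-0 part q of the closed-open map
at A is a unital ring homomorphism QH -> hom(A, A) ([q_len0M], [q_len01]). The
open-closed map p, restricted to length-0 chains, is adjoint to q for the
intersection form on QH and the cyclic pairing on hom(A, A)
([p_len0_adjoint]). Both algebras are Frobenius: on QH this is the symmetry of
Gromov-Witten invariants ([qmul_frobenius]), on hom(A, A) the cyclicity of m_2
([hprod_cyclic]). Therefore p is QH-linear, and since q(x) e1 is a multiple of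
e1, the class p(e1) is a common eigenvector of all the operators x *
([qmul_p_len0], [p_len0_eigenvector]); likewise for e2.

By the Cardy relation <p(s), p(t)> is, up to sign, the supertrace of
u |-> s u t on hom(A, A). It is 0 for (s, t) = (e1, e2) and nonzero for
s = t = e1 ([cardy_p_len0]). A common eigenvector of nonzero norm is a multiple
of an idempotent spanning a one-dimensional ideal ([eigenvector_idempotent]),
and two such eigenvectors that are orthogonal for the intersection form have
product 0 ([eigenvectors_orthogonal]). This gives e_L^+ and e_L^-.

Finally c_1 is the image of half the Maslov class, so q(c_1) is the sum of the
disk terms T^omega(beta) m_{0,beta} weighted by mu(beta)/2. The degree-d part
of m_{0,beta} vanishes unless mu(beta) = 2 - d, so the weight is constant on
each degree part of the potential equation, whose right-hand side W 1_L has
degree 0, where the weight is 1. Hence q(c_1) = W 1_L ([q_len0_c1]), and c_1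
acts on both idempotents by the potential W. *)

Set Implicit Arguments.
Unset Strict Implicit.
Unset Printing Implicit Defensive.

Import Order.TTheory GRing.Theory Num.Theory.

Local Open Scope ring_scope.

(** * Sums in the Novikov field *)

Section NovikovSums.
Variable R : realType.

Fact ncst_zmod_morphism : zmod_morphism (@ncst R).
Proof.
move=> c d; apply: nov_inj => x; rewrite ncoefB !ncoef_mono.
by case: (x == 0); rewrite ?subr0.
Qed.

Fact ncst_monoid_morphism : monoid_morphism (@ncst R).
Proof.
split=> [|c d]; first exact: nmono01.
by rewrite /ncst nmonoM addr0.
Qed.

HB.instance Definition _ := GRing.isZmodMorphism.Build R[i] (Lam R) (@ncst R)
  ncst_zmod_morphism.
HB.instance Definition _ := GRing.isMonoidMorphism.Build R[i] (Lam R) (@ncst R)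
  ncst_monoid_morphism.

Lemma ncst_sgn e : ncst (sgn e) = sgn e :> Lam R.
Proof. exact: rmorph_sign. Qed.

Lemma nov_sums_unique (J : eqType) (x : J -> Lam R) (a a' : Lam R) :
  nov_sums x a -> nov_sums x a' -> a = a'.
Proof.
move=> xa xa'; apply: nov_inj => t.
have [F HF] := xa t; have [F' HF'] := xa' t.
have sub : {subset F <= undup (F ++ F')} /\ {subset F' <= undup (F ++ F')}.
  by split=> i iF; rewrite mem_undup mem_cat iF ?orbT.
have := HF _ (undup_uniq _) sub.1 t (lexx _).
have := HF' _ (undup_uniq _) sub.2 t (lexx _).
rewrite !ncoefB => /eqP; rewrite subr_eq0 => /eqP <-.
by move=> /eqP; rewrite subr_eq0 => /eqP.
Qed.

Lemma eq_nov_sums (J : eqType) (x y : J -> Lam R) (a : Lam R) :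
  x =1 y -> nov_sums x a -> nov_sums y a.
Proof. by move=> /funext ->. Qed.

Lemma nov_sumsZ (J : eqType) (c : R[i]) (x : J -> Lam R) (a : Lam R) :
  nov_sums x a -> nov_sums (fun j => ncst c * x j) (ncst c * a).
Proof.
move=> xa E; have [F HF] := xa E; exists F => G uG FG t tE.
by rewrite -mulr_sumr -mulrBr nmonoMl subr0 HF ?mulr0.
Qed.

End NovikovSums.

(** * Bilinear maps in coordinates *)

Section Bilinear.
Variable K : comPzRingType.

Lemma bilin_linearl d1 d2 d3 (c : 'I_d1 -> 'I_d2 -> 'rV[K]_d3) a u v y :
  bilin c (a *: u + v) y = a *: bilin c u y + bilin c v y.
Proof.
rewrite /bilin scaler_sumr -big_split; apply: eq_bigr => i _ /=.
rewrite scaler_sumr -big_split; apply: eq_bigr => j _ /=.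
by rewrite !mxE mulrDl scalerDl scalerA mulrA.
Qed.

Lemma bilin_linearr d1 d2 d3 (c : 'I_d1 -> 'I_d2 -> 'rV[K]_d3) a x u v :
  bilin c x (a *: u + v) = a *: bilin c x u + bilin c x v.
Proof.
rewrite /bilin scaler_sumr -big_split; apply: eq_bigr => i _ /=.
rewrite scaler_sumr -big_split; apply: eq_bigr => j _ /=.
by rewrite !mxE mulrDr scalerDl scalerA mulrCA.
Qed.

Lemma bilin0l d1 d2 d3 (c : 'I_d1 -> 'I_d2 -> 'rV[K]_d3) y : bilin c 0 y = 0.
Proof.
by rewrite /bilin big1 // => i _; rewrite big1 // => j _; rewrite mxE mul0r scale0r.
Qed.

Lemma bilin0r d1 d2 d3 (c : 'I_d1 -> 'I_d2 -> 'rV[K]_d3) x : bilin c x 0 = 0.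
Proof.
by rewrite /bilin big1 // => i _; rewrite big1 // => j _; rewrite mxE mulr0 scale0r.
Qed.

Lemma bilinZl d1 d2 d3 (c : 'I_d1 -> 'I_d2 -> 'rV[K]_d3) a x y :
  bilin c (a *: x) y = a *: bilin c x y.
Proof. by rewrite -[a *: x]addr0 bilin_linearl bilin0l addr0. Qed.

Lemma bilinZr d1 d2 d3 (c : 'I_d1 -> 'I_d2 -> 'rV[K]_d3) a x y :
  bilin c x (a *: y) = a *: bilin c x y.
Proof. by rewrite -[a *: y]addr0 bilin_linearr bilin0r addr0. Qed.

(** Both arguments are expanded in bases, so that a multiplicativity statement
need only be checked on basis vectors. *)
Lemma bilin_mulmx d1 d2 d3 e1 e2 (c : 'I_d1 -> 'I_d2 -> 'rV[K]_d3)
    (P : 'M_(e1, d1)) (P' : 'M_(e2, d2)) x y :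
  bilin c (x *m P) (y *m P') =
  bilin (fun i j => bilin c (row i P) (row j P')) x y.
Proof.
have addl y' : {morph bilin c ^~ y' : u v / u + v}.
  by move=> u v; rewrite -[u]scale1r bilin_linearl !scale1r.
have addr x' : {morph bilin c x' : u v / u + v}.
  by move=> u v; rewrite -[u]scale1r bilin_linearr !scale1r.
rewrite !mulmx_sum_row (big_morph _ (addl _) (bilin0l _ _)).
apply: eq_bigr => i _; rewrite (big_morph _ (addr _) (bilin0r _ _)).
by apply: eq_bigr => j _; rewrite bilinZl bilinZr scalerA.
Qed.

Lemma mul_bilin_mx d1 d2 d3 d4 (c : 'I_d1 -> 'I_d2 -> 'rV[K]_d3)
    (P : 'M_(d3, d4)) x y :
  bilin c x y *m P = bilin (fun i j => c i j *m P) x y.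
Proof.
rewrite mulmx_suml; apply: eq_bigr => i _.
by rewrite mulmx_suml; apply: eq_bigr => j _; rewrite -scalemxAl.
Qed.

Lemma eq_bilin d1 d2 d3 (c c' : 'I_d1 -> 'I_d2 -> 'rV[K]_d3) x y :
  (forall i j, c i j = c' i j) -> bilin c x y = bilin c' x y.
Proof. by move=> cc'; apply: eq_bigr => i _; apply: eq_bigr => j _; rewrite cc'. Qed.

Definition gram d1 d2 (P : 'I_d1 -> 'I_d2 -> K) := \matrix_(i, j) P i j.

Lemma bilin_formE d1 d2 (P : 'I_d1 -> 'I_d2 -> K) x y :
  bilin_form P x y = (x *m gram P *m y^T) 0 0.
Proof.
rewrite mxE /bilin_form exchange_big; apply: eq_bigr => j _ /=.
rewrite !mxE mulr_suml; apply: eq_bigr => i _.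
by rewrite !mxE mulrAC.
Qed.

Lemma bilin_formZl d1 d2 (P : 'I_d1 -> 'I_d2 -> K) a x y :
  bilin_form P (a *: x) y = a * bilin_form P x y.
Proof. by rewrite !bilin_formE -!scalemxAl mxE. Qed.

Lemma bilin_formZr d1 d2 (P : 'I_d1 -> 'I_d2 -> K) a x y :
  bilin_form P x (a *: y) = a * bilin_form P x y.
Proof. by rewrite !bilin_formE linearZ /= -!scalemxAr mxE. Qed.

Lemma bilin_form0r d1 d2 (P : 'I_d1 -> 'I_d2 -> K) x : bilin_form P x 0 = 0.
Proof. by rewrite bilin_formE trmx0 mulmx0 mxE. Qed.

Lemma bilin_form_bvec_r d1 d2 (P : 'I_d1 -> 'I_d2 -> K) x j :
  bilin_form P x (bvec j) = \sum_i x 0 i * P i j.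
Proof.
rewrite bilin_formE trmx_delta -colE !mxE.
by apply: eq_bigr => i _; rewrite !mxE.
Qed.

Lemma bilin_form_bvec_l d1 d2 (P : 'I_d1 -> 'I_d2 -> K) i y :
  bilin_form P (bvec i) y = \sum_j P i j * y 0 j.
Proof.
by rewrite bilin_formE -rowE mxE; apply: eq_bigr => j _; rewrite !mxE.
Qed.

(** With its mirror image below, this reduces an identity between the trilinear
forms P(c(x, y), z) and P(z, c(x, y)) to basis vectors. *)
Lemma bilin_form_bilinl d1 d2 d3 d4 (P : 'I_d3 -> 'I_d4 -> K)
    (c : 'I_d1 -> 'I_d2 -> 'rV[K]_d3) x y z :
  bilin_form P (bilin c x y) z =
  \sum_i \sum_j \sum_k x 0 i * y 0 j * z 0 k * bilin_form P (c i j) (bvec k).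
Proof.
have add : {morph (fun u => bilin_form P u z) : u v / u + v}.
  by move=> u v; rewrite !bilin_formE !mulmxDl mxE.
have f0 : bilin_form P 0 z = 0 by rewrite bilin_formE !mul0mx mxE.
rewrite (big_morph _ add f0); apply: eq_bigr => i _.
rewrite (big_morph _ add f0); apply: eq_bigr => j _.
rewrite bilin_formZl bilin_formE mxE mulr_sumr; apply: eq_bigr => k _.
rewrite bilin_form_bvec_r [z^T _ _]mxE [_ * z 0 k]mulrC mulrA; congr (_ * _).
by rewrite mxE; apply: eq_bigr => m _; rewrite mxE.
Qed.

Lemma bilin_form_bilinr d1 d2 d3 d4 (P : 'I_d4 -> 'I_d3 -> K)
    (c : 'I_d1 -> 'I_d2 -> 'rV[K]_d3) x y z :
  bilin_form P z (bilin c x y) =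
  \sum_i \sum_j \sum_k x 0 i * y 0 j * z 0 k * bilin_form P (bvec k) (c i j).
Proof.
have add : {morph bilin_form P z : u v / u + v}.
  by move=> u v; rewrite !bilin_formE linearD mulmxDr mxE.
rewrite (big_morph _ add (bilin_form0r _ _)); apply: eq_bigr => i _.
rewrite (big_morph _ add (bilin_form0r _ _)); apply: eq_bigr => j _.
rewrite bilin_formZr bilin_formE -mulmxA mxE mulr_sumr; apply: eq_bigr => k _.
rewrite bilin_form_bvec_l mulrA; congr (_ * _).
by rewrite mxE; apply: eq_bigr => m _; rewrite !mxE.
Qed.

End Bilinear.

(** * Quantum cohomology as a Frobenius algebra *)

Section QuantumCohomology.
Variables (R : realType) (n : nat) (X : symplectic R n).
Implicit Types x y z v w : QH X.
Local Notation one := (toQH (coh1 (HX X))).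

(** Graded symmetry of the Poincare pairing: in even total dimension only classes
of equal parity pair, so the sign (-1)^(|i||j|) depends on one of them. *)
Lemma ipair_sgn (N : nat) (K : fieldType) (H : cohring K N) (i j : 'I_(gdim H)) :
  ~~ odd N -> ipair i j = sgn (odd (gdeg i)) * ipair j i.
Proof.
move=> evN; rewrite /ipair mulr_sumr; apply: eq_bigr => k _.
have [->|ik] := eqVneq (integral k) 0; first by rewrite !mulr0.
rewrite cupC mxE mulrA; have [->|cji] := eqVneq (cup j i 0 k) 0.
  by rewrite !mulr0.
have oij : odd (gdeg j + gdeg i) = false.
  by rewrite -(cup_deg cji) (integral_deg ik) (negbTE evN).
congr (sgn _ * _ * _); move: oij; rewrite oddD oddM.
by case: (odd (gdeg j)) (odd (gdeg i)) => [] [].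
Qed.

Lemma intersection_sgn (i : 'I_(gdim (HX X))) x :
  intersection (bvec i) x = sgn (odd (gdeg i)) * intersection x (bvec i).
Proof.
rewrite /intersection bilin_form_bvec_l bilin_form_bvec_r mulr_sumr.
apply: eq_bigr => k _; rewrite ipair_sgn ?oddM // rmorphM /= ncst_sgn.
by rewrite -mulrA [ncst _ * _]mulrC.
Qed.

(** The sign of the cyclic permutation is (-1)^(|i|(|j| + |k|)). The dimension
formula makes |i| + |j| + |k| even, which turns it into (-1)^|i|. *)
Lemma GW3_rot a (i j k : 'I_(gdim (HX X))) :
  GW3 a j k i = sgn (odd (gdeg i)) * GW3 a i j k.
Proof.
rewrite GW3_sym23 GW3_sym12 mulrA.
have [->|G0] := eqVneq (GW3 a i j k) 0; first by rewrite !mulr0.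
have := GW3_deg G0 => /(congr1 (fun z : int => odd `|z|)).
have -> : odd `|(2 * n)%N%:Z + 2 * c1Z X a| = false.
  have -> : (2 * n)%N%:Z + 2 * c1Z X a = 2 * (n%:Z + c1Z X a).
    by rewrite mulrDr PoszM.
  by rewrite abszM oddM.
rewrite absz_nat !oddD /sgn -signr_addb !oddM => odd_sum.
congr ((-1) ^+ nat_of_bool _ * _); move: odd_sum.
by case: (odd (gdeg i)) (odd (gdeg j)) (odd (gdeg k)) => [] [] [].
Qed.

(** Both sides are sums of the same three-point invariants up to cyclic
permutation, and the sign of the permutation cancels that of the symmetry of the
pairing. *)
Lemma qprod_rot (i j k : 'I_(gdim (HX X))) :
  intersection (qprod i j) (bvec k) = intersection (bvec i) (qprod j k).
Proof.
have ijk := nov_sumsZ (sgn (odd (gdeg i))) (qprodE i j k).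
have -> : intersection (bvec i) (qprod j k) =
    sgn (odd (gdeg i)) * intersection (qprod j k) (bvec i).
  exact: intersection_sgn.
have -> : intersection (qprod j k) (bvec i) =
    ncst (sgn (odd (gdeg i))) * intersection (qprod i j) (bvec k).
  apply: nov_sums_unique (qprodE j k i) _.
  apply: eq_nov_sums ijk => a; rewrite (GW3_rot a i j k) rmorphM /=.
  exact: mulrCA.
by rewrite ncst_sgn mulrA /sgn -signr_addb addbb mul1r.
Qed.

Lemma qmul_frobenius x y z :
  intersection (qmul x y) z = intersection x (qmul y z).
Proof.
rewrite /intersection bilin_form_bilinl bilin_form_bilinr.
rewrite exchange_big; apply: eq_bigr => j _ /=.
rewrite exchange_big; apply: eq_bigr => k _ /=.
apply: eq_bigr => i _.
have rot := qprod_rot i j k; rewrite /intersection in rot.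
rewrite rot.
have -> : y 0 j * z 0 k * x 0 i = x 0 i * y 0 j * z 0 k.
  by rewrite mulrC mulrA.
by [].
Qed.

(** Poincare duality makes the Gram matrix invertible over C, and invertibility
survives the extension of scalars to the Novikov field. *)
Lemma intersection_nondeg v : (forall x, intersection x v = 0) -> v = 0.
Proof.
set P := \matrix_(i, j) (ipair i j : R[i]) : 'M_(gdim (HX X)).
have freeP : row_free P.
  apply: inj_row_free => x xP; apply: poincare_duality => j.
  move/rowP/(_ j): xP; rewrite !mxE => xPj; rewrite -[RHS]xPj.
  by apply: eq_bigr => i _; rewrite mxE.
have unitP : map_mx (@ncst R) P \in unitmx.
  by rewrite map_unitmx -row_free_unit.
move=> Hv; have Pv0 : map_mx (@ncst R) P *m v^T = 0.
  apply/colP => i; rewrite mxE [RHS]mxE -[RHS](Hv (bvec i)).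
  by rewrite /intersection bilin_form_bvec_l; apply: eq_bigr => j _; rewrite !mxE.
by apply: trmx_inj; rewrite -[v^T](mulKmx unitP) Pv0 mulmx0 trmx0.
Qed.

(** If v * v = a v, then a <1, v> = <1, v * v> = <v, v> by the Frobenius property,
so a is invertible and v / a is idempotent. The ideal it generates is the line
spanned by v because every x acts on v by a scalar. *)
Lemma eigenvector_idempotent v :
    (forall x, exists a, qmul x v = a *: v) -> intersection v v != 0 ->
  exists2 c : Lam R, c != 0 &
    [/\ qmul (c *: v) (c *: v) = c *: v, c *: v != 0 & ideal_isom_Lam (c *: v)].
Proof.
move=> eig vv; have [a va] := eig v.
have a0 : a != 0.
  apply: contraNneq vv => a0.
  (* a <1, v> = <1, v * v> = <v, v> *)
  rewrite -[X in intersection X _](qprod1x v) -/(qmul _ _) qmul_frobenius va a0.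
  by rewrite scale0r /intersection bilin_form0r.
have v0 : v != 0.
  by apply: contraNneq vv => ->; rewrite /intersection bilin_form0r.
exists a^-1; first by rewrite invr_eq0.
set e := a^-1 *: v.
have ee : qmul e e = e.
  rewrite /e /qmul bilinZl bilinZr -/(qmul v v) va !scalerA -mulrA mulVf //.
  by rewrite mulr1.
have e0 : e != 0 by rewrite scaler_eq0 negb_or invr_eq0 a0.
have eig_e x : exists b, qmul x e = b *: e.
  have [b xv] := eig x; exists b.
  by rewrite /e /qmul bilinZr -/(qmul x v) xv !scalerA mulrC.
clearbody e; split=> //.
exists (fun b => b *: e); split=> [b c d|b c||b c|y].
- by rewrite scalerDl scalerA.
- by rewrite /qmul bilinZl bilinZr -/(qmul e e) ee scalerA.
- exact: scale1r.
- move/eqP; rewrite -subr_eq0 -scalerBl scaler_eq0 (negbTE e0) orbF subr_eq0.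
  by move/eqP.
- split=> [[b ->]|[x ->]]; last exact: eig_e.
  by exists (b *: e); rewrite /qmul bilinZl -/(qmul e e) ee.
Qed.

(** Writing v * w = a w, one has a <1, w> = <1, v * w> = <v, w> = 0, whereas
<1, w> is nonzero as a factor of <w, w>. *)
Lemma eigenvectors_orthogonal v w :
    (forall x, exists a, qmul x w = a *: w) -> intersection w w != 0 ->
  intersection v w = 0 -> qmul v w = 0.
Proof.
move=> eig ww vw; have [a vwE] := eig v; have [b wwE] := eig w.
have one_w u : intersection one (qmul u w) = intersection u w.
  by rewrite -qmul_frobenius /qmul qprod1x.
have w1 : intersection one w != 0.
  apply: contraNneq ww => w1.
  by rewrite -one_w wwE /intersection bilin_formZr -/(intersection _ _) w1 mulr0.
have /eqP := one_w v; rewrite vw vwE /intersection bilin_formZr -/(intersection _ _).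
by rewrite mulf_eq0 (negbTE w1) orbF => /eqP ->; rewrite scale0r.
Qed.

End QuantumCohomology.

(** * An object whose endomorphisms have even degree *)

Section EvenEndomorphisms.
Variables (K : fieldType) (n : nat) (Q : quiver) (F : ainf_cat K n Q) (A : Q).
Hypothesis even_hom : forall i : 'I_(hdim A A), hpar i = false.
Local Notation m := (am F).
Local Notation hom := 'rV[K]_(hdim A A).
Implicit Types x y z u : hom.

(** m_1 changes the parity. *)
Lemma m1_even : m1 F A A = 0.
Proof.
apply/matrixP => i j; rewrite !mxE; apply/eqP/negPn/negP => /(@am_par _ _ _ F).
by rewrite /= !even_hom.
Qed.

Lemma hclosed_even x : hclosed F x.
Proof. by rewrite /hclosed m1_even mulmx0. Qed.

Lemma exact_even x : exact_el F x -> x = 0.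
Proof. by case=> y ->; rewrite m1_even mulmx0. Qed.

Lemma hprod_even x y :
  hprod F x y = bilin (fun i j => m (wsnoc (wsnoc (wnil A) i) j)) x y.
Proof. by apply: eq_bilin => i j; rewrite !even_hom scale1r. Qed.

Lemma hprod1e x : hprod F (aunit F A) x = x.
Proof.
rewrite hprod_even {2}(row_sum_delta x) /bilin exchange_big.
apply: eq_bigr => j _; rewrite -[delta_mx 0 j](aunit_l F) scaler_sumr.
apply: eq_bigr => k _.
by rewrite scalerA mulrC.
Qed.

Lemma hprode1 x : hprod F x (aunit F A) = x.
Proof.
rewrite hprod_even {2}(row_sum_delta x); apply: eq_bigr => i _.
have -> : delta_mx 0 i = ins m (wsnoc (wnil A) i) (aunit F A) (wnil A).
  by rewrite aunit_r even_hom scale1r.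
by rewrite scaler_sumr; apply: eq_bigr => k _; rewrite scalerA.
Qed.

(** Cyclicity of m_2; in even degree all the signs are trivial. *)
Lemma hprod_cyclic x y z :
  bilin_form (acyc F A A) (hprod F x y) z =
  bilin_form (acyc F A A) (hprod F z x) y.
Proof.
rewrite !hprod_even !bilin_form_bilinl.
under eq_bigr do rewrite exchange_big /=.
rewrite exchange_big; apply: eq_bigr => k _.
apply: eq_bigr => i _; apply: eq_bigr => j _ /=.
rewrite !bilin_form_bvec_r acyc_cyc /= !even_hom /= mul1r.
by rewrite [z 0 k * _]mulrC [x 0 i * _ * _]mulrAC.
Qed.

Lemma acyc_sym x y :
  bilin_form (acyc F A A) x y = bilin_form (acyc F A A) y x.
Proof.
by rewrite -[x in LHS]hprode1 hprod_cyclic hprod_cyclic hprod1e.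
Qed.

(** Two rotations give <x u, e> = <u e, x>. *)
Lemma hprod_eigenvector e u a x : hprod F u e = a *: e ->
  bilin_form (acyc F A A) (hprod F x u) e = a * bilin_form (acyc F A A) x e.
Proof. by move=> ue; rewrite 2!hprod_cyclic ue bilin_formZl acyc_sym. Qed.

(** In length 0, the Hochschild differential only involves m_0 = 0 and m_1 = 0. *)
Lemma hdiff_nil a (theta : cochain K Q) : hdiff F a theta (wnil A) = 0.
Proof.
rewrite /hdiff /= !big_seq1 /= am_nil andbF addbF scale1r.
have -> : ins m (wnil A) (theta A A (wnil A)) (wnil A) =
    theta A A (wnil A) *m m1 F A A.
  rewrite mulmx_sum_row; apply: eq_bigr => k _; congr (_ *: _).
  by apply/rowP => j; rewrite !mxE.
rewrite m1_even mulmx0 add0r /ins big1 ?scaler0 // => k _.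
by rewrite mxE scale0r.
Qed.

Lemma cohomologous_nil a (phi psi : cochain K Q) :
  cohomologous F a phi psi -> phi A A (wnil A) = psi A A (wnil A).
Proof. by case=> theta _ ->; rewrite hdiff_nil addr0. Qed.

(** In length 0, m_2 is the only operation occurring in the cup product, because
the splittings of the empty word are trivial. *)
Lemma hcup_nil a b (phi psi : cochain K Q) :
    cochain_par a phi -> cochain_par b psi ->
  hcup F a b phi psi (wnil A) =
    hprod F (phi A A (wnil A)) (psi A A (wnil A)).
Proof.
move=> phi_a psi_b; rewrite /hcup /= !big_seq1 /= !andbF.
have -> : sgn ((a && b) (+) a) *:
    (sgn (false (+) false) *:
       ins2 m (wnil A) (phi A A (wnil A)) (wnil A) (psi A A (wnil A)) (wnil A)) =
  sgn ((a && b) (+) a) *: hprod F (phi A A (wnil A)) (psi A A (wnil A)).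
  rewrite scale1r hprod_even; congr (_ *: _); apply: eq_bigr => i _.
  by rewrite scaler_sumr; apply: eq_bigr => j _; rewrite scalerA.
case: a phi_a => [phi1|_]; last by rewrite scale1r.
(* A cochain of odd degree has no length-0 part at A. *)
suff -> : phi A A (wnil A) = 0 by rewrite /hprod bilin0l scaler0.
apply/rowP => k; rewrite mxE; apply/eqP/negPn/negP => /phi1.
by rewrite even_hom.
Qed.

(** The boundary of a chain of length 0 is given by m_0 and m_1. *)
Lemma hcycle_len0 x : hcycle F (len0 x).
Proof.
move=> f; rewrite /hb /len0 big_flatten big_map big_map big1 // => k _.
rewrite big_map /hb_gen /= !cats0 big_cat !big_map /=.
rewrite !big1 ?addr0 // => j _; last by rewrite am_nil mxE !(mulr0, mul0r).
have := congr1 (fun M : 'M_(_, _) => M k j) m1_even; rewrite !mxE => ->.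
by rewrite !(mulr0, mul0r).
Qed.

Lemma chain_par_len0 x : chain_par false (len0 x).
Proof.
rewrite /chain_par all_map; apply/allP => k _.
by rewrite /= /gpar /= even_hom.
Qed.

Local Notation "x ** y" := (@hprod K n Q F A A A x y) (at level 40).

Definition idempotent_pair e1 e2 :=
  [/\ e1 ** e1 = e1, e2 ** e2 = e2, e1 ** e2 = 0, e2 ** e1 = 0 &
      e1 != 0 /\ e2 != 0].

(** As m_1 = 0, every element is closed and none but 0 is exact, so the isomorphism
on cohomology is injective on hom(A, A) and the preimages of (1, 0) and (0, 1)
multiply as these do. *)
Lemma HF_isom_idempotent_pair (S T : nzRingType) : HF_isom F A (S * T)%type ->
  exists e1 e2 : hom, idempotent_pair e1 e2.
Proof.
case=> f [fD fM _ f0 fsurj].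
have closed x := hclosed_even x.
have f_0 : f 0 = 0 by apply/f0 => //; exists 0; rewrite mul0mx.
have f_inj x y : f x = f y -> x = y.
  move=> fxy; apply/subr0_eq/exact_even/f0 => //.
  by apply: (addIr (f y)); rewrite -fD // subrK add0r.
have [e1 _ fe1] := fsurj (1, 0); have [e2 _ fe2] := fsurj (0, 1).
have fMM x y : f (x ** y) = f x * f y by exact: fM.
have mulE (a b c : S * T) : a.1 * b.1 = c.1 -> a.2 * b.2 = c.2 -> a * b = c.
  by case: c => c1 c2 /= <- <-.
exists e1, e2; split.
- by apply: f_inj; rewrite fMM fe1; apply: mulE => /=; rewrite ?mulr1 ?mulr0.
- by apply: f_inj; rewrite fMM fe2; apply: mulE => /=; rewrite ?mulr1 ?mulr0.
- by apply: f_inj; rewrite fMM fe1 fe2 f_0; apply: mulE; rewrite ?mulr0 ?mul0r.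
- by apply: f_inj; rewrite fMM fe1 fe2 f_0; apply: mulE; rewrite ?mulr0 ?mul0r.
split; apply/eqP => e0.
  by move: fe1; rewrite e0 f_0 => -[/esym/eqP]; rewrite oner_eq0.
by move: fe2; rewrite e0 f_0 => -[/esym/eqP]; rewrite oner_eq0.
Qed.

Lemma idempotent_pairC e1 e2 : idempotent_pair e1 e2 -> idempotent_pair e2 e1.
Proof. by case=> ? ? ? ? []. Qed.

(** In a vanishing combination a e1 + b e2, right multiplication by e1 isolates
a e1. *)
Lemma idempotent_pair_free e1 e2 : idempotent_pair e1 e2 -> row_free (col_mx e1 e2).
Proof.
case=> e11 _ _ e21 [e1n0 e2n0]; apply: inj_row_free => v.
rewrite -[v]hsubmxK mul_row_col [lsubmx v]mx11_scalar [rsubmx v]mx11_scalar.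
rewrite !mul_scalar_mx; set a := lsubmx v 0 0; set b := rsubmx v 0 0 => ab0.
have a0 : a = 0.
  have := congr1 (fun x => x ** e1) ab0.
  rewrite /hprod bilin_linearl bilinZl bilin0l -!/(hprod _ _ _) e11 e21 scaler0.
  by rewrite addr0 => /eqP; rewrite scaler_eq0 (negbTE e1n0) orbF => /eqP.
have b0 : b = 0.
  move: ab0; rewrite a0 scale0r add0r => /eqP.
  by rewrite scaler_eq0 (negbTE e2n0) orbF => /eqP.
by rewrite a0 b0 !raddf0 row_mx0.
Qed.

Lemma idempotent_pair_span e1 e2 : hdim A A = 2%N -> idempotent_pair e1 e2 ->
  forall u, exists a b, u = a *: e1 + b *: e2.
Proof.
move=> dim2 /idempotent_pair_free free u.
have /submxP[v ->] : (u <= col_mx e1 e2)%MS.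
  by apply: submx_full; rewrite /row_full (eqP free) dim2.
exists (lsubmx v 0 0), (rsubmx v 0 0).
by rewrite -[v in LHS]hsubmxK mul_row_col -!mul_scalar_mx -!mx11_scalar.
Qed.

Lemma idempotent_pair_eigenvector e1 e2 : hdim A A = 2%N -> idempotent_pair e1 e2 ->
  forall u, exists a, u ** e1 = a *: e1.
Proof.
move=> dim2 e12 u; have [a [b ->]] := idempotent_pair_span dim2 e12 u.
have [e11 _ _ e21 _] := e12; exists a.
by rewrite /hprod bilin_linearl bilinZl -!/(hprod _ _ _) e11 e21 scaler0 addr0.
Qed.

Lemma idempotent_pair_basis e1 e2 : hdim A A = 2%N -> idempotent_pair e1 e2 ->
  cohom_basis F (col_mx e1 e2) (fun => false).
Proof.
move=> dim2 e12; split=> [i|x _|c /exact_even ce].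
- by split; [exact: hclosed_even | move=> k _; exact: even_hom].
- have [a [b ->]] := idempotent_pair_span dim2 e12 x.
  exists (row_mx a%:M b%:M); exists 0.
  by rewrite mul_row_col !mul_scalar_mx subrr mul0mx.
by apply: (row_free_inj (idempotent_pair_free e12)); rewrite ce mul0mx.
Qed.

(** hom(A, A) is its own cohomology and is even, so the supertrace is the trace,
computed here in an eigenbasis. *)
Lemma idempotent_pair_supertrace (f : bool -> hom -> hom) t e1 e2 a b :
    hdim A A = 2%N -> idempotent_pair e1 e2 ->
    f false e1 = a *: e1 -> f false e2 = b *: e2 ->
  is_supertrace F f t -> t = a + b.
Proof.
move=> dim2 e12 fe1 fe2.
move=> /(_ _ _ _ (block_mx a%:M 0 0 b%:M) (idempotent_pair_basis dim2 e12)) ->.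
  by rewrite big_split_ord /= !big_ord1 block_mxEul block_mxEdr !mxE !mul1r.
move=> i; exists 0; rewrite mul0mx; apply/eqP; rewrite subr_eq0; apply/eqP.
rewrite -row_mul mul_block_col !mul0mx addr0 add0r !mul_scalar_mx.
case: (split_ordP i) => j ->; rewrite !(rowKu, rowKd) ord1.
  by rewrite [row _ e1]row_id fe1 row_id.
by rewrite [row _ e2]row_id fe2 row_id.
Qed.

End EvenEndomorphisms.

(** * Length-0 parts of the open-closed maps *)

Section OpenClosed.
Variables (R : realType) (n : nat) (X : symplectic R n).
Variables (I : finType) (L : I -> lagrangian X) (Fk : fukaya L).
Variable OC : open_closed Fk.
Local Notation Q := (Quiver (@fhpar _ _ _ _ _ Fk)).
Local Notation F := (fcat Fk).
Variable A : Q.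
Hypothesis even_hom : forall i : 'I_(hdim A A), hpar i = false.
Hypothesis even_n : ~~ odd n.
Local Notation hom := 'rV[Lam R]_(hdim A A).
Implicit Types (x y : QH X) (u e : hom).
Local Notation "x ** y" := (@hprod _ _ _ F A A A x y) (at level 40).
Local Notation cyc := (bilin_form (acyc F A A)).

Definition q_len0 x : hom := qext OC x (wnil A).
Definition p_len0 e : QH X := pext OC (len0 e).

Definition q_len0_mx : 'M[Lam R]_(gdim (HX X), hdim A A) :=
  \matrix_i qmap OC i (wnil A).
Definition p_len0_mx : 'M[Lam R]_(hdim A A, gdim (HX X)) :=
  \matrix_k Defs.pmap OC (HGen (wnil A) k).

Lemma q_len0E x : q_len0 x = x *m q_len0_mx.
Proof. by rewrite mulmx_sum_row; apply: eq_bigr => i _; rewrite rowK. Qed.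

Lemma p_len0E e : p_len0 e = e *m p_len0_mx.
Proof.
rewrite mulmx_sum_row /p_len0 /pext /len0 big_map big_enum.
by apply: eq_bigr => i _; rewrite rowK.
Qed.

Lemma q_len01 : q_len0 (toQH (coh1 (HX X))) = aunit F A.
Proof. exact: (cohomologous_nil even_hom (qmap1 OC)). Qed.

Lemma q_len0M x y : q_len0 (qmul x y) = q_len0 x ** q_len0 y.
Proof.
rewrite !q_len0E mul_bilin_mx /hprod bilin_mulmx; apply: eq_bilin => i j.
rewrite -q_len0E /q_len0 (cohomologous_nil even_hom (qmapM OC i j)).
by rewrite (hcup_nil F even_hom) ?rowK //; exact: qmap_par.
Qed.

(** On basis vectors, the definition of p through q. The signs are trivial since n
and the degrees in hom(A, A) are even. *)
Lemma p_len0_mx_adjoint :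
  gram (fun i j : 'I_(gdim (HX X)) => ncst (ipair i j)) *m p_len0_mx^T =
  q_len0_mx *m gram (acyc F A A).
Proof.
apply/matrixP => i k; have := pmapE OC i (HGen (wnil A) k).
rewrite /intersection bilin_form_bvec_l (negbTE even_n) mul1r /cyc_gen /= andbF.
rewrite mul1r !mxE => pE; under eq_bigr do rewrite !mxE.
by rewrite pE; apply: eq_bigr => j _; rewrite !mxE.
Qed.

Lemma p_len0_adjoint x e : intersection x (p_len0 e) = cyc (q_len0 x) e.
Proof.
rewrite /intersection !bilin_formE p_len0E q_len0E trmx_mul.
by rewrite -[x *m q_len0_mx *m _]mulmxA -p_len0_mx_adjoint !mulmxA.
Qed.

(** p is a map of QH-modules. Tested against y, this is the chain
<y, x * p(e)> = <y * x, p(e)> = <q(y) q(x), e> = a <q(y), e> = <y, a p(e)>. *)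
Lemma qmul_p_len0 x e a : q_len0 x ** e = a *: e -> qmul x (p_len0 e) = a *: p_len0 e.
Proof.
move=> xe; apply/eqP; rewrite -subr_eq0; apply/eqP/intersection_nondeg => y.
have sub (u v : QH X) : intersection y (u - v) = intersection y u - intersection y v.
  by rewrite /intersection !bilin_formE linearB mulmxBr !mxE.
rewrite sub -qmul_frobenius p_len0_adjoint q_len0M (hprod_eigenvector even_hom _ xe).
by rewrite /intersection bilin_formZr -/(intersection _ _) p_len0_adjoint subrr.
Qed.

(** The Cardy relation for u |-> s u t; c is the product of its signs. *)
Lemma cardy_p_len0 s t e1 e2 a b : hdim A A = 2%N -> idempotent_pair F e1 e2 ->
    (s ** e1) ** t = a *: e1 -> (s ** e2) ** t = b *: e2 ->
  exists2 c : Lam R, c != 0 & intersection (p_len0 s) (p_len0 t) = c * (a + b).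
Proof.
move=> dim2 e12 ste1 ste2.
have even_el u : el_par false u by move=> k _; exact: even_hom.
have str := mukai_len0 OC (hclosed_even F even_hom s) (hclosed_even F even_hom t)
  (even_el s) (even_el t).
have := cardy OC (hcycle_len0 F even_hom s) (hcycle_len0 F even_hom t)
  (chain_par_len0 even_hom s).
rewrite (idempotent_pair_supertrace (a := a) (b := b) even_hom dim2 e12 _ _ str);
  [|by rewrite scale1r..].
by exists ((-1) ^+ (n * n.+1)./2 * sgn (cardy_sign OC (odd n) false));
  rewrite ?mulf_neq0 // signr_eq0.
Qed.

Lemma p_len0_eigenvector e1 e2 : hdim A A = 2%N -> idempotent_pair F e1 e2 ->
  forall x, exists a, qmul x (p_len0 e1) = a *: p_len0 e1.
Proof.
move=> dim2 e12 x.
have [a xe] := idempotent_pair_eigenvector dim2 e12 (q_len0 x).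
by exists a; apply: qmul_p_len0.
Qed.

Lemma p_len0_norm e1 e2 : hdim A A = 2%N -> idempotent_pair F e1 e2 ->
  intersection (p_len0 e1) (p_len0 e1) != 0.
Proof.
move=> dim2 e12; have [e11 _ e12_0 _ _] := e12.
have [||c c0 ->] := @cardy_p_len0 e1 e1 e1 e2 1 0 dim2 e12.
- by rewrite e11 e11 scale1r.
- by rewrite e12_0 scale0r /hprod bilin0l.
by rewrite addr0 mulr1.
Qed.

Lemma p_len0_orthogonal e1 e2 : hdim A A = 2%N -> idempotent_pair F e1 e2 ->
  intersection (p_len0 e1) (p_len0 e2) = 0.
Proof.
move=> dim2 e12; have [e11 _ e12_0 _ _] := e12.
have [||c c0 ->] := @cardy_p_len0 e1 e2 e1 e2 0 0 dim2 e12.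
- by rewrite e11 e12_0 scale0r.
- by rewrite e12_0 scale0r /hprod bilin0l.
by rewrite addr0 mulr0.
Qed.

(** The eigenvalue of c is common to the two idempotents because q(c) is a scalar
multiple of the unit. *)
Lemma QH_idempotents e1 e2 (c : QH X) (lambda : Lam R) :
    hdim A A = 2%N -> idempotent_pair F e1 e2 -> q_len0 c = lambda *: aunit F A ->
  exists ep em : QH X,
    [/\ qmul ep ep = ep, qmul em em = em,
        ideal_isom_Lam ep, ideal_isom_Lam em & qmul ep em = 0] /\
    [/\ ep != 0, em != 0, qmul c ep = lambda *: ep & qmul c em = lambda *: em].
Proof.
move=> dim2 e12 cE; have e21 := idempotent_pairC e12.
have [a a0 [epp ep0 ep_isom]] :=
  eigenvector_idempotent (p_len0_eigenvector dim2 e12) (p_len0_norm dim2 e12).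
have [b b0 [emm em0 em_isom]] :=
  eigenvector_idempotent (p_len0_eigenvector dim2 e21) (p_len0_norm dim2 e21).
have c_eig e r : qmul c (r *: p_len0 e) = lambda *: (r *: p_len0 e).
  rewrite /qmul bilinZr -/(qmul _ _) (@qmul_p_len0 _ _ lambda).
    by rewrite !scalerA mulrC.
  by rewrite cE /hprod bilinZl -/(hprod _ _ _) hprod1e.
exists (a *: p_len0 e1), (b *: p_len0 e2); do 2 split=> //.
rewrite /qmul bilinZl bilinZr -/(qmul _ _).
rewrite (eigenvectors_orthogonal (p_len0_eigenvector dim2 e21)) ?scaler0 //.
  exact: p_len0_norm e21.
exact: p_len0_orthogonal.
Qed.

End OpenClosed.

(** * The cohomology of a sphere *)

Section Sphere.
Variables (R : realType) (n : nat) (X : symplectic R n) (L : lagrangian X).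
Hypothesis even_n : ~~ odd n.
Hypothesis sphere : rational_homology_sphere L.

Lemma sphere_gdeg (i : 'I_(gdim (HL L))) : (gdeg i == 0%N) || (gdeg i == n).
Proof.
apply/negPn; rewrite negb_or; apply/negP => /andP[i0 iN].
have := sphere (gdeg i); rewrite (negbTE i0) (negbTE iN) => /card0_eq /(_ i).
by rewrite !inE eqxx.
Qed.

(** For n = 0 both basis vectors have degree 0, otherwise one has degree 0 and the
other degree n. *)
Lemma sphere_gdim : gdim (HL L) = 2%N.
Proof.
pose deg0 := [pred i : 'I_(gdim (HL L)) | gdeg i == 0%N].
transitivity (#|deg0| + #|[predC deg0]|)%N; first by rewrite cardC card_ord.
rewrite sphere eqxx; have [n0|n0] := eqVneq n 0%N.
  rewrite eq_card0 // => i; rewrite !inE; apply/negbTE/negPn.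
  by case/orP: (sphere_gdeg i) => // /eqP ->; rewrite n0.
rewrite addn0; congr S.
transitivity #|[pred i : 'I_(gdim (HL L)) | gdeg i == n]|.
  apply: eq_card => i; rewrite !inE; have := sphere_gdeg i.
  by case: eqP => [->|_ /= ->] //; rewrite eq_sym (negbTE n0).
by rewrite sphere (negbTE n0) eqxx.
Qed.

Lemma sphere_even (i : 'I_(gdim (HL L))) : odd (gdeg i) = false.
Proof. by case/orP: (sphere_gdeg i) => /eqP ->; rewrite // (negbTE even_n). Qed.

End Sphere.

(** * The disk potential *)

Section Potential.
Variables (R : realType) (n : nat) (X : symplectic R n) (L : lagrangian X).

(** A class in H^2(X, L) whose image in H^2(X) is c_1. *)
Definition half_maslov (a : H2L L) : R[i] := (maslov L a)%:~R / 2%:R.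

Fact half_maslov_zmod_morphism : zmod_morphism half_maslov.
Proof. by move=> a a'; rewrite /half_maslov raddfB intrB mulrBl. Qed.

HB.instance Definition _ :=
  GRing.isZmodMorphism.Build (H2L L) R[i] half_maslov half_maslov_zmod_morphism.

Variable b : mcelt L.
Hypothesis b0 : bplus b = 0.

(** For b = 0 only s = 0 contributes, and m_{0,beta} has degree 2 - mu(beta). *)
Lemma disk_degree (sb : nat * H2L L) k :
  mext (@mdisk _ _ _ L sb.2) (nseq sb.1 (bplus b)) 0 k != 0 ->
  maslov L sb.2 = 2 - (gdeg k)%:Z.
Proof.
case: sb => [[|s] a] /=; last first.
  by rewrite b0 big1 ?mxE ?eqxx // => i _; rewrite mxE scale0r.
rewrite mxE fmorph_eq0 => /mdisk_deg ->.
by rewrite big_nil add0r subr0 subKr.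
Qed.

(** In degree d the weight mu(beta)/2 equals the constant (2 - d)/2, so each
coordinate is that constant times the same coordinate of W 1_L; the latter is
zero for d > 0, and for d = 0 the constant is 1. *)
Lemma half_maslov_sum v :
    nov_sums_mx
      (fun sb : nat * H2L L =>
         (ncst (half_maslov sb.2 * rho b (bdL L sb.2)) *
            Tpow (omegaL L sb.2 / (2 * pi))) *:
           mext (@mdisk _ _ _ L sb.2) (nseq sb.1 (bplus b))) v ->
  v = potential b *: map_mx (@ncst R) (coh1 (HL L)).
Proof.
move=> v_sum; apply/rowP => k.
pose c : R[i] := (2 - (gdeg k)%:Z)%:~R / 2%:R.
have -> : v 0 k = ncst c * (potential b *: map_mx (@ncst R) (coh1 (HL L))) 0 k.
  apply: nov_sums_unique (v_sum k) _.
  apply: eq_nov_sums (nov_sumsZ c (mc_eq b k)) => sb; rewrite !mxE.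
  have [->|/disk_degree mu] :=
    eqVneq (mext (@mdisk _ _ _ L sb.2) (nseq sb.1 (bplus b)) 0 k) 0.
    by rewrite !mulr0.
  by rewrite /half_maslov mu -/c (rmorphM _ c) !mulrA.
rewrite !mxE; have [->|/coh1_deg k0] := eqVneq (coh1 (HL L) 0 k) 0.
  by rewrite rmorph0 !mulr0.
by rewrite /c k0 subr0 divff ?rmorph1 ?mul1r // pnatr_eq0.
Qed.

End Potential.

(** * The object of a sphere *)

Section SphereObject.
Variables (R : realType) (n : nat) (X : symplectic R n).
Variables (I : finType) (L : I -> lagrangian X) (Fk : fukaya L).
Variables (l : I) (b : mcelt (L l)).
Local Notation A := (FObj b : Quiver (@fhpar _ _ _ _ _ Fk)).
Hypothesis even_n : ~~ odd n.
Hypothesis sphere : rational_homology_sphere (L l).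
Hypothesis rho1 : forall g, rho b g = 1.

(** The local system from A to itself has trivial monodromy. *)
Lemma hom_self_HL :
  hdim A A = gdim (HL (L l)) /\
  forall (i : 'I_(hdim A A)) (j : 'I_(gdim (HL (L l)))),
    i = j :> nat -> hpar i = odd (gdeg j).
Proof.
have := fhom_self Fk (erefl (potential b)).
have -> : (fun g => rho b g / rho b g) = fun _ => 1.
  by apply/funext => g; rewrite rho1 divr1.
by rewrite Hloc_triv.
Qed.

Lemma sphere_hdim : hdim A A = 2%N.
Proof. by rewrite hom_self_HL.1 sphere_gdim. Qed.

Lemma sphere_hpar (i : 'I_(hdim A A)) : hpar i = false.
Proof.
case: hom_self_HL => dimE parE.
by rewrite (parE i (cast_ord dimE i)) // sphere_even.
Qed.

Lemma q_len0_c1 (OC : open_closed Fk) : bplus b = 0 ->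
  q_len0 OC A (toQH (c1 X)) = potential b *: aunit (fcat Fk) A.
Proof.
move=> b0.
have [a|v [u [/(half_maslov_sum b0) -> [dimE uE]]]] :=
  @qmap_rel _ _ _ _ _ _ OC l b (@half_maslov _ _ _ (L l)) _ (@c1_deg _ _ X).
  rewrite c1ZE /= /half_maslov maslov_rel intrM mulrC mulKf //.
  by rewrite pnatr_eq0.
move=> /(exact_even sphere_hpar)/subr0_eq; rewrite -/(q_len0 OC A _) => ->.
apply/rowP => k; rewrite (uE k (cast_ord dimE k)) // !mxE.
by have [_ unitE] := funit_self Fk b; rewrite (unitE k (cast_ord dimE k)) ?mxE.
Qed.

End SphereObject.

Theorem proposition1p4 (R : realType) (n : nat) (X : symplectic R n)
    (I : finType) (L : I -> lagrangian X) (Fk : fukaya L) (OC : open_closed Fk)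
    (l : I) (b : mcelt (L l)) :
  ~~ odd n ->
  rational_homology_sphere (L l) ->
  (forall g, rho b g = 1) ->
  bplus b = 0 ->
  HF_isom (fcat Fk) (FObj b) (Lam R * Lam R)%type ->
  exists ep em : QH X,
    [/\ qmul ep ep = ep, qmul em em = em,
        ideal_isom_Lam ep, ideal_isom_Lam em & qmul ep em = 0] /\
    exists lambda : Lam R,
      [/\ ep != 0, em != 0,
          qmul (toQH (c1 X)) ep = lambda *: ep &
          qmul (toQH (c1 X)) em = lambda *: em].
Proof.
move=> even_n sphere rho1 b0 HF.
have even_hom := sphere_hpar (Fk := Fk) even_n sphere rho1.
have [e1 [e2 e12]] := HF_isom_idempotent_pair even_hom HF.
have [ep [em [? ?]]] := QH_idempotents even_hom even_n
  (sphere_hdim Fk sphere rho1) e12 (q_len0_c1 even_n sphere rho1 OC b0).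
by exists ep, em; split=> //; exists (potential b).
Qed.
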